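(* Let $D\subseteq\mathbb{R}^2$ be a convex Jordan domain. Then $\mathrm{SC}(D)=w(D)$, i.e. the sweeping cost of $D$ equals the width of $D$.
   Context: A Jordan domain $D\subseteq\mathbb{R}^2$ is a homeomorphic image of a closed disk in $\mathbb{R}^2$, with boundary $\partial D$. $L(\gamma)$ denotes the length of a continuous path $\gamma$ (and the length of a line segment); $\gamma$ is rectifiable if $L(\gamma)<\infty$. Let $I=[0,1]$. A sensor curve in $D$ is a continuous map $f\colon I\times I\to D$ such that (i) each curve $f(\cdot,t)\colon I\to D$ is rectifiable and injective for $t\in(0,1)$; (ii) $f(I,0)$ and $f(I,1)$ are each (possibly distinct) single points in $\partial D$; (iii) $f(s,t)\in\partial D$ implies $s\in\{0,1\}$ or $t\in\{0,1\}$. Standing assumption: attention is restricted to sensor curves for which the converse of (iii) holds as well, i.e. $f(s,t)\in\partial D$ if and only if $s\in\{0,1\}$ or $t\in\{0,1\}$. The length of a sensor curve is $L(f)=\max_{t\in I}L(f(\cdot,t))$. A sensor curve $f$ is a sweep of $D$ if for every continuous path $\gamma\colon I\to D$ there is some $t\in I$ with $\gamma(t)\in f(I,t)$. Let $\mathcal{F}(D)$ be the set of all sensor curves that are sweeps of $D$. The sweeping cost of $D$ is $\mathrm{SC}(D)=\inf_{f\in\mathcal{F}(D)}L(f)$. The width of a convex Jordan domain $D$ is $w(D)=\min_{\|v\|=1}\ \max_{x\in\mathbb{R}^2}\ L(D\cap\{x+tv\ |\ t\in\mathbb{R}\})$, where $v$ ranges over unit vectors in $\mathbb{R}^2$; equivalently,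 $w(D)$ is the smallest distance between two parallel supporting lines on opposite sides of $D$. *)

(* Defs.v *)
From HB Require Import structures.
From mathcomp Require Import all_boot all_order all_algebra.
From mathcomp Require Import all_classical all_reals all_analysis.

Set Implicit Arguments.
Unset Strict Implicit.
Unset Printing Implicit Defensive.

Import Order.TTheory GRing.Theory Num.Theory.
Import numFieldNormedType.Exports.

Local Open Scope classical_set_scope.
Local Open Scope ring_scope.

(* The plane is R * R. Its library topology is the Euclidean one, but its
   library norm is the sup norm, so lengths below use enorm instead of `|_|. *)
Definition enorm (R : realType) (p : R * R) : R :=
  Num.sqrt (p.1 ^+ 2 + p.2 ^+ 2).

Definition closed_disk (R : realType) (c : R * R) (r : R) : set (R * R) :=
  [set p | enorm (p - c) <= r].

Definition homeomorphic (S T : topologicalType) (A : set S) (B : set T) : Prop :=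
  exists (phi : S -> T) (psi : T -> S),
    [/\ set_bij A B phi,
        {in A, cancel phi psi},
        {within A, continuous phi}
      & {within B, continuous psi}].

Definition jordan_domain (R : realType) (D : set (R * R)) : Prop :=
  exists c : R * R, exists2 r : R, 0 < r & homeomorphic (closed_disk c r) D.

(* For a Jordan domain, the topological boundary is also the image of the
   boundary circle under any homeomorphism from a disk (invariance of domain). *)
Definition boundary (T : topologicalType) (D : set T) : set T :=
  closure D `\` interior D.

Definition polygonal_length (R : realType) (a b : R) (g : R -> R * R)
    (s : seq R) : R :=
  let F := g \o nth b (a :: s) in
  \sum_(0 <= n < size s) enorm (F n.+1 - F n).

(* Planar analogue of total_variation. *)
Definition path_length (R : realType) (a b : R) (g : R -> R * R) : \bar R :=
  ereal_sup [set (polygonal_length a b g s)%:E | s in itv_partition a b].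

Definition unit_itv (R : realType) : set R := `[0, 1]%classic.
Arguments unit_itv R : clear implicits.

(* Paths and sensor curves are total functions whose values outside I and I x I
   are irrelevant. The pair (s, t) is (position along the curve, time). *)
Record sensor_curve (R : realType) (D : set (R * R)) (f : R * R -> R * R)
    : Prop := SensorCurve {
  sensor_continuous : {within unit_itv R `*` unit_itv R, continuous f};
  sensor_in : set_fun (unit_itv R `*` unit_itv R) D f;
  sensor_rectifiable : forall t : R, 0 < t < 1 ->
    (path_length 0 1 (fun s => f (s, t)) < +oo)%E;
  sensor_injective : forall t : R, 0 < t < 1 ->
    set_inj (unit_itv R) (fun s => f (s, t));
  sensor_start : exists2 p, boundary D p &
    forall s, unit_itv R s -> f (s, 0) = p;
  sensor_end : exists2 p, boundary D p &
    forall s, unit_itv R s -> f (s, 1) = p;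
  sensor_boundary : forall s t, unit_itv R s -> unit_itv R t ->
    (boundary D (f (s, t)) <-> (s = 0 \/ s = 1) \/ (t = 0 \/ t = 1))
}.

Definition sensor_length (R : realType) (f : R * R -> R * R) : \bar R :=
  ereal_sup [set path_length 0 1 (fun s => f (s, t)) | t in unit_itv R].

Definition sweep (R : realType) (D : set (R * R)) (f : R * R -> R * R) : Prop :=
  sensor_curve D f /\
  forall g : R -> R * R,
    {within unit_itv R, continuous g} -> set_fun (unit_itv R) D g ->
    exists2 t, unit_itv R t & exists2 s, unit_itv R s & f (s, t) = g t.

Definition sweeping_cost (R : realType) (D : set (R * R)) : \bar R :=
  ereal_inf [set sensor_length f | f in [set f | sweep D f]].

(* When v is a unit vector, t |-> x + t v is an isometric parametrization, so
   this Lebesgue measure is the length of the chord of D on the line through x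
   in direction v (0 if the line misses D). *)
Definition chord_length (R : realType) (D : set (R * R)) (x v : R * R)
    : \bar R :=
  lebesgue_measure [set t : R | D (x + t *: v)].

Definition width (R : realType) (D : set (R * R)) : \bar R :=
  ereal_inf [set ereal_sup [set chord_length D x v | x in [set: R * R]]
            | v in [set v : R * R | enorm v = 1]].

(* Main.v *)
(* Lower bound.  Let f be a sweep of length less than w(D).  Its curves touch
   the boundary only at their ends a(t), b(t) (or at times 0 and 1), so an
   evader running on the boundary only has to avoid these two points.  With pi
   the nearest point projection onto D and c an interior point, z - pi z for
   z = a + eta (a - c) is a normal vector of D at a point close to a, which
   depends continuously on a.  The unit normals n(a), n(b) are never opposite,
   since otherwise D would lie in a strip not much wider than |a - b| < w(D).
   Hence u = - (n(a) + n(b)) can be normalized, and the evader pi (c + M u), for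
   M large, stays away from a(t) and b(t) by monotonicity of the normal cones.

   Upper bound.  If the chords of D in direction v shrink to points at both
   ends, they form a sweep.  The boundary of D contains segments in at most
   countably many directions, so every v can be replaced by a nearby direction
   without this defect, at the price of slightly longer chords. *)

Require Import Defs.
From HB Require Import structures.
From mathcomp Require Import all_boot all_order all_algebra.
From mathcomp Require Import all_classical all_reals all_analysis.
From mathcomp Require Import ring lra.
Set Implicit Arguments.
Unset Strict Implicit.
Unset Printing Implicit Defensive.
Import Order.TTheory GRing.Theory Num.Theory.
Import numFieldNormedType.Exports.
Local Open Scope classical_set_scope.
Local Open Scope ring_scope.

(** * Euclidean geometry of the plane *)

Section Euclid.
Context {R : realType}.
Implicit Types p q x y z : R * R.

Definition dotp p q : R := p.1 * q.1 + p.2 * q.2.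

Definition perp p : R * R := (- p.2, p.1).

Lemma dotpC p q : dotp p q = dotp q p.
Proof. by rewrite /dotp; ring. Qed.

Lemma dotpDr p x y : dotp p (x + y) = dotp p x + dotp p y.
Proof. by rewrite /dotp /=; ring. Qed.

Lemma dotpNr p x : dotp p (- x) = - dotp p x.
Proof. by rewrite /dotp /=; ring. Qed.

Lemma dotpBr p x y : dotp p (x - y) = dotp p x - dotp p y.
Proof. by rewrite dotpDr dotpNr. Qed.

Lemma dotpZr p (k : R) x : dotp p (k *: x) = k * dotp p x.
Proof. by rewrite /dotp /=; rewrite /GRing.scale/=; ring. Qed.

Lemma dotpZl (k : R) p x : dotp (k *: p) x = k * dotp p x.
Proof. by rewrite dotpC dotpZr dotpC. Qed.

Lemma dotpDl p q x : dotp (p + q) x = dotp p x + dotp q x.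
Proof. by rewrite dotpC dotpDr !(dotpC x). Qed.

Lemma dotpNl p x : dotp (- p) x = - dotp p x.
Proof. by rewrite dotpC dotpNr dotpC. Qed.

Lemma dotpBl p q x : dotp (p - q) x = dotp p x - dotp q x.
Proof. by rewrite dotpDl dotpNl. Qed.

Lemma dotp_ge0 p : 0 <= dotp p p.
Proof. by rewrite /dotp; nra. Qed.

Lemma enormE p : enorm p = Num.sqrt (dotp p p).
Proof. by rewrite /enorm /dotp !expr2. Qed.

Lemma enorm_ge0 p : 0 <= enorm p.
Proof. by rewrite /enorm sqrtr_ge0. Qed.

Lemma enorm_sqr p : enorm p ^+ 2 = dotp p p.
Proof. by rewrite enormE sqr_sqrtr// dotp_ge0. Qed.

Lemma dotp_eq0 p : dotp p p = 0 -> p = 0.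
Proof.
case: p => a b; rewrite /dotp/= => h.
have -> : a = 0 by nra.
have -> : b = 0 by nra.
by [].
Qed.

Lemma enorm0_eq0 p : enorm p = 0 -> p = 0.
Proof. by move=> h; apply: dotp_eq0; rewrite -enorm_sqr h expr0n. Qed.

Lemma enorm0 : enorm (0 : R * R) = 0.
Proof. by rewrite enormE /dotp/= !mul0r addr0 sqrtr0. Qed.

Lemma enormN p : enorm (- p) = enorm p.
Proof. by rewrite !enormE dotpNr dotpNl opprK. Qed.

Lemma enormB p q : enorm (p - q) = enorm (q - p).
Proof. by rewrite -enormN opprB. Qed.

Lemma enormZ (k : R) p : enorm (k *: p) = `|k| * enorm p.
Proof.
by rewrite !enormE dotpZr dotpZl mulrA -expr2 sqrtrM ?sqr_ge0// sqrtr_sqr.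
Qed.

Lemma enorm_unit p : enorm p = 1 -> dotp p p = 1.
Proof. by move=> h; rewrite -enorm_sqr h expr1n. Qed.

Lemma enorm_le p (k : R) : 0 <= k -> (enorm p <= k) = (dotp p p <= k ^+ 2).
Proof. by move=> k0; rewrite -enorm_sqr ler_pXn2r// nnegrE// enorm_ge0. Qed.

Lemma cauchy_schwarz p q : dotp p q <= enorm p * enorm q.
Proof.
have [h|h] := leP (dotp p q) 0; first by apply: le_trans h _; rewrite mulr_ge0 ?enorm_ge0.
have k0 : 0 <= enorm p * enorm q by rewrite mulr_ge0 ?enorm_ge0.
rewrite -(@ler_pXn2r _ 2)// ?nnegrE//; last exact: ltW.
rewrite exprMn !enorm_sqr.
rewrite /dotp; have : 0 <= (p.1 * q.2 - p.2 * q.1) ^+ 2 by rewrite sqr_ge0.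
by rewrite !expr2; lra.
Qed.

Lemma cauchy_schwarzN p q : - (enorm p * enorm q) <= dotp p q.
Proof. by rewrite lerNl -dotpNr -(enormN q) cauchy_schwarz. Qed.

Lemma ler_enormD p q : enorm (p + q) <= enorm p + enorm q.
Proof.
rewrite enorm_le ?addr_ge0 ?enorm_ge0// dotpDr !dotpDl (dotpC q p).
have := cauchy_schwarz p q; have := enorm_sqr p; have := enorm_sqr q.
by rewrite !expr2; lra.
Qed.

Lemma ler_fst_enorm p : `|p.1| <= enorm p.
Proof.
by rewrite -ler_sqr ?nnegrE ?enorm_ge0// real_normK ?num_real//
  enorm_sqr /dotp -expr2 lerDl -expr2 sqr_ge0.
Qed.

Lemma ler_snd_enorm p : `|p.2| <= enorm p.
Proof.
by rewrite -ler_sqr ?nnegrE ?enorm_ge0// real_normK ?num_real//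
  enorm_sqr /dotp -expr2 lerDr sqr_ge0.
Qed.

Lemma perp_orth p : dotp (perp p) p = 0.
Proof. by rewrite /dotp /perp/=; ring. Qed.

Lemma enorm_perp p : enorm (perp p) = enorm p.
Proof. by rewrite !enormE; congr Num.sqrt; rewrite /dotp /perp/=; ring. Qed.

Lemma orth_decomp v x : enorm v = 1 ->
  x = dotp (perp v) x *: perp v + dotp v x *: v.
Proof.
move=> /enorm_unit; case: v x => a b [c d]; rewrite /dotp /perp/= => h.
congr pair; rewrite /= /GRing.scale/=.
  (* Multiplying the left side by [dotp v v = 1] makes both sides homogeneous, so that [ring]
     applies. *)
  by rewrite -[LHS]mulr1 -h; ring.
by rewrite -[LHS]mulr1 -h; ring.
Qed.

Lemma continuous_fst : continuous (@fst R R).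
Proof. by move=> x; apply: cvg_fst. Qed.

Lemma continuous_snd : continuous (@snd R R).
Proof. by move=> x; apply: cvg_snd. Qed.

Lemma continuous_dotp (T : topologicalType) (f g : T -> R * R) (t : T) :
  {for t, continuous f} -> {for t, continuous g} ->
  {for t, continuous (fun u => dotp (f u) (g u))}.
Proof.
move=> cf cg; rewrite /dotp.
have f1 : {for t, continuous (fst \o f)} := continuous_comp cf (@continuous_fst _).
have f2 : {for t, continuous (snd \o f)} := continuous_comp cf (@continuous_snd _).
have g1 : {for t, continuous (fst \o g)} := continuous_comp cg (@continuous_fst _).
have g2 : {for t, continuous (snd \o g)} := continuous_comp cg (@continuous_snd _).
exact: (@cvgD _ _ _ _ _ _ _ _ _ (cvgM f1 g1) (cvgM f2 g2)).
Qed.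

Lemma continuous_dotpr p : continuous (dotp p).
Proof. by move=> x; apply: continuous_dotp => //; exact: cst_continuous. Qed.

Lemma continuous_enorm : continuous (@enorm R).
Proof.
have -> : @enorm R = Num.sqrt \o (fun p => dotp p p) by apply/funext => p; rewrite enormE.
move=> x; apply: continuous_comp; first exact: continuous_dotp.
exact: sqrt_continuous.
Qed.

(** Library balls are balls of the sup norm. That norm is at most [enorm], which gives one
    direction; continuity of [enorm] gives the other. *)
Lemma nbhs_enormP p (A : set (R * R)) :
  nbhs p A <-> exists2 e : R, 0 < e & forall q, enorm (q - p) < e -> A q.
Proof.
split.
  move=> /nbhs_ballP[e /= e0 h]; exists e => // q hq; apply: h.
  split; rewrite /ball/= distrC.
    exact: le_lt_trans (ler_fst_enorm (q - p)) hq.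
  exact: le_lt_trans (ler_snd_enorm (q - p)) hq.
move=> [e e0 h].
have c : {for p, continuous (fun q => enorm (q - p))}.
  by apply: (continuous_comp (cvgB cvg_id (cvg_cst p))); exact: continuous_enorm.
have : nbhs p [set q | enorm (q - p) < e].
  apply: (c [set r | r < e]); rewrite /= subrr enorm0.
  exact: lt_nbhsl.
by apply: filterS => q; exact: h.
Qed.

Lemma enorm_lipschitz_continuous (f : R * R -> R * R) :
  (forall x y, enorm (f x - f y) <= enorm (x - y)) -> continuous f.
Proof.
move=> h x A /nbhs_enormP[e e0 eA]; apply/nbhs_enormP; exists e => // q hq.
by apply: eA; exact: le_lt_trans (h _ _) hq.
Qed.

End Euclid.

(** * Convex Jordan domains are compact with nonempty interior *)

Lemma within_continuous_precomp (S T U : topologicalType) (A : set S) (B : set T)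
    (g : S -> T) (f : T -> U) :
  continuous g -> set_fun A B g -> {within B, continuous f} ->
  {within A, continuous f \o g}.
Proof.
move=> cg AB /subspace_continuousP cf; apply/subspace_continuousP => x Ax.
apply: cvg_comp (cf _ (AB _ Ax)).
move=> W; rewrite /within /= => WB.
have := cg x _ WB; rewrite /nbhs/= => h.
by move: h; apply: filterS => y h Ay; apply: h; exact: AB.
Qed.

Lemma continuous_precomp (S T U : topologicalType) (B : set T)
    (g : S -> T) (f : T -> U) :
  continuous g -> set_fun setT B g -> {within B, continuous f} ->
  continuous (f \o g).
Proof.
move=> cg sg cf; apply/continuous_subspace_setT.
exact: within_continuous_precomp cg sg cf.
Qed.

Section Disk.
Context {R : realType}.
Implicit Types c p q : R * R.

Lemma closed_disk_compact c (r : R) : compact (closed_disk c r).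
Proof.
have cd : closed (closed_disk c r).
  have -> : closed_disk c r = (fun p => enorm (p - c)) @^-1` [set t | t <= r] by [].
  apply: preimage_closed; last exact: closed_le.
  move=> x _; apply: (continuous_comp (cvgB cvg_id (cvg_cst c))).
  exact: continuous_enorm.
apply: (subclosed_compact cd (@compact_setX _ _ `[c.1 - r, c.1 + r] `[c.2 - r, c.2 + r]
  (@segment_compact _ _ _) (@segment_compact _ _ _))).
move=> p /= pr; rewrite !in_itv/=.
have /ler_normlP[] := le_trans (ler_fst_enorm _) pr.
have /ler_normlP[] := le_trans (ler_snd_enorm _) pr.
by rewrite /=; split; lra.
Qed.

(* The two values at the ends of a diameter would force, by the intermediate
   value theorem, a common value on the diameter and on an arc off it. *)
Lemma closed_disk_no_injection c (r : R) (f : R * R -> R) : 0 < r ->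
  {within closed_disk c r, continuous f} -> ~ set_inj (closed_disk c r) f.
Proof.
move=> r0 cf fi.
(* [g1] runs along the horizontal diameter and [g2] along a parabolic arc above it, with the same
   abscissas and the same two ends. The arc is at distance [r * (1 + t * t) / 2] from [c], so it
   stays in the disk. *)
pose g1 (t : R) := (c.1 + r * t, c.2 + 0 * t).
pose g2 (t : R) := (c.1 + r * t, c.2 + r * (1 - t * t) / 2).
have ca (a b : R) : continuous (fun t : R => a + b * t).
  move=> t; apply: cvgD; first exact: cvg_cst.
  by apply: cvgM; [exact: cvg_cst | exact: cvg_id].
have c1 : continuous g1 by move=> t; exact: (cvg_pair (ca _ _ t) (ca _ _ t)).
have cq : continuous (fun t : R => c.2 + r * (1 - t * t) / 2).
  move=> t; apply: cvgD; first exact: cvg_cst.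
  apply: cvgM; last exact: cvg_cst.
  apply: cvgM; first exact: cvg_cst.
  apply: cvgB; first exact: cvg_cst.
  by apply: cvgM; exact: cvg_id.
have c2 : continuous g2 by move=> t; exact: (cvg_pair (ca _ _ t) (cq t)).
have d1 : set_fun `[-1, 1] (closed_disk c r) g1.
  move=> t /=; rewrite in_itv/= /closed_disk/= => /andP[ta tb].
  rewrite (enorm_le _ (ltW r0)) /dotp /=.
  have -> : (c.1 + r * t - c.1) * (c.1 + r * t - c.1) +
     (c.2 + 0 * t - c.2) * (c.2 + 0 * t - c.2) = r ^+ 2 * (t * t) by ring.
  by rewrite ler_piMr ?sqr_ge0//; nra.
have d2 : set_fun `[-1, 1] (closed_disk c r) g2.
  move=> t /=; rewrite in_itv/= /closed_disk/= => /andP[ta tb].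
  rewrite (enorm_le _ (ltW r0)) /dotp /=.
  have -> : (c.1 + r * t - c.1) * (c.1 + r * t - c.1) +
     (c.2 + r * (1 - t * t) / 2 - c.2) * (c.2 + r * (1 - t * t) / 2 - c.2) =
     r ^+ 2 * ((1 + t * t) / 2) ^+ 2 by field.
  have h : 0 <= (1 + t * t) / 2 <= 1 by apply/andP; split; nra.
  by rewrite ler_piMr ?sqr_ge0// expr_le1//; case/andP: h.
have w1 := within_continuous_precomp c1 d1 cf.
have w2 := within_continuous_precomp c2 d2 cf.
have em : g1 (-1) = g2 (-1) by rewrite /g1 /g2; congr pair; field.
have ep : g1 1 = g2 1 by rewrite /g1 /g2; congr pair; field.
have m11 : (-1 : R) <= 1 by lra.
(* The mean of the two end values is attained both on the diameter and on the arc. *)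
pose v := (f (g1 (-1)) + f (g1 1)) / 2.
have hv : Num.min (f (g1 (-1))) (f (g1 1)) <= v <= Num.max (f (g1 (-1))) (f (g1 1)).
  rewrite /v; case: (leP (f (g1 (-1))) (f (g1 1))) => h; apply/andP; split; lra.
have [t1 t1i e1] := IVT m11 w1 hv.
have hv2 : Num.min ((f \o g2) (-1)) ((f \o g2) 1) <= v <=
    Num.max ((f \o g2) (-1)) ((f \o g2) 1).
  by rewrite /= -em -ep.
have [t2 t2i e2] := IVT m11 w2 hv2.
have e12 : g1 t1 = g2 t2.
  apply: fi; rewrite ?inE; [exact: d1|exact: d2|by rewrite /= in e1 e2; rewrite e1 e2].
(* Equal abscissas give [t1 = t2]; equal ordinates then put the common point at an end of the
   diameter. So [v] is an end value, and as the mean of both it makes them agree. *)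
have tt : t1 = t2.
  move: e12 => [+ _] => /addrI /mulfI; apply; by rewrite gt_eqF.
have t1sq : (1 - t1) * (1 + t1) = 0.
  move: e12 => [_]; rewrite mul0r => /addrI; rewrite -tt => e.
  have : r * ((1 - t1) * (1 + t1)) = 0 by lra.
  by move/eqP; rewrite mulf_eq0 gt_eqF//= => /eqP.
have i1 : (1 : R) \in `[-1, 1] by rewrite in_itv/=; apply/andP; split; lra.
have im1 : (-1 : R) \in `[-1, 1] by rewrite in_itv/=; apply/andP; split; lra.
have fe : f (g1 (-1)) = f (g1 1).
  move/eqP: t1sq; rewrite mulf_eq0 => /orP[] /eqP h.
    have t11 : t1 = 1 by lra.
    by rewrite /= t11 /v in e1; lra.
  have t11 : t1 = -1 by lra.
  by rewrite /= t11 /v in e1; lra.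
have : g1 (-1) = g1 1 by apply: fi; rewrite ?inE//; [exact: d1|exact: d1].
by rewrite /g1 => -[+ _] => /addrI /mulfI; rewrite gt_eqF// => /(_ isT); lra.
Qed.

(** Convexity with a plain real coefficient in place of the interval-typed scalar of
    [convex_set]. *)
Definition convex_comb_closed (D : set (R * R)) := forall p q (k : R),
  D p -> D q -> 0 <= k <= 1 -> D ((1 - k) *: p + k *: q).

Lemma convex_setP (D : set (R * R)) : convex_set D -> convex_comb_closed D.
Proof.
move=> cD p q k Dp Dq k01.
have k01' : Itv.spec (@Itv.num_sem R) (Itv.Real `[0%Z, 1%Z]) k.
  by rewrite /= /Itv.num_sem /= in_itv/= k01 num_real.
have := cD q p (Itv.mk k01').
rewrite !inE => /(_ Dq Dp).
by rewrite /conv /= addrC.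
Qed.

Lemma jordan_domain_compact (D : set (R * R)) : jordan_domain D -> compact D.
Proof.
move=> [c [r r0 [phi [psi [[fphi _ surj] _ cphi _]]]]].
have -> : D = phi @` closed_disk c r.
  apply/seteqP; split; first exact: surj.
  by move=> _ [x hx <-]; exact: fphi.
by apply: continuous_compact => //; exact: closed_disk_compact.
Qed.

(** Twice the signed area of the triangle [p q x]. *)
Definition det3 p q x : R := dotp (perp (q - p)) (x - p).

(** The barycentric coordinates [l1], [l2], [l3] are continuous and all equal 1/3 at the centroid,
    so they remain positive near it. *)
Lemma interior_of_triangle (D : set (R * R)) p q x : convex_comb_closed D ->
  D p -> D q -> D x -> det3 p q x != 0 -> exists c, interior D c.
Proof.
move=> cD Dp Dq Dx d0.
pose d := det3 p q x.
pose l1 y := det3 q x y / d.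
pose l2 y := det3 x p y / d.
pose l3 y := det3 p q y / d.
have cdet a b : continuous (det3 a b).
  move=> y; apply: (continuous_comp (cvgB cvg_id (cvg_cst a))).
  exact: continuous_dotpr.
have cl a b : continuous (fun y => det3 a b y / d).
  by move=> y; apply: cvgM; [exact: cdet | exact: cvg_cst].
have sum1 y : l1 y + l2 y + l3 y = 1.
  apply: (mulIf d0); rewrite /l1 /l2 /l3 -!mulrDl divfK// mul1r.
  by rewrite /d /det3 /dotp /perp /=; ring.
have dec y : y = l1 y *: p + l2 y *: q + l3 y *: x.
  apply: (scalerI d0); rewrite !scalerDr !scalerA /l1 /l2 /l3.
  rewrite ![det3 p q x * _]mulrC !divfK//.
  case: y p q x {Dp Dq Dx d0 d l1 l2 l3 cl sum1} => y1 y2 [p1 p2] [q1 q2] [x1 x2].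
  rewrite /det3 /dotp /perp /=; congr pair; rewrite /= /GRing.scale/=; ring.
pose c : R * R := (1/3) *: p + (1/3) *: q + (1/3) *: x.
have lc : [/\ 0 < l1 c, 0 < l2 c & 0 < l3 c].
  have h1 : l1 c = 1/3.
    by apply: (mulIf d0); rewrite /l1 divfK// /d /det3 /dotp /perp /c /=
      /GRing.scale/=; field.
  have h2 : l2 c = 1/3.
    by apply: (mulIf d0); rewrite /l2 divfK// /d /det3 /dotp /perp /c /=
      /GRing.scale/=; field.
  have h3 : l3 c = 1/3.
    by apply: (mulIf d0); rewrite /l3 divfK// /d /det3 /dotp /perp /c /=
      /GRing.scale/=; field.
  by rewrite h1 h2 h3; split; lra.
exists c; have [a1 a2 a3] := lc.
have n1 : nbhs c [set y | 0 < l1 y] := cl q x c _ (lt_nbhsr a1).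
have n2 : nbhs c [set y | 0 < l2 y] := cl x p c _ (lt_nbhsr a2).
have n3 : nbhs c [set y | 0 < l3 y] := cl p q c _ (lt_nbhsr a3).
apply: filterS (filterI n1 (filterI n2 n3)).
move=> y [/= b1 [b2 b3]].
have s23 : 0 < l2 y + l3 y by lra.
(* Two-point convexity is applied twice: on the segment from [q] to [x], then from [p] to the point
   obtained there. *)
have -> : y = (1 - (l2 y + l3 y)) *: p + (l2 y + l3 y) *:
    ((1 - l3 y / (l2 y + l3 y)) *: q + (l3 y / (l2 y + l3 y)) *: x).
  have -> : 1 - (l2 y + l3 y) = l1 y by have := sum1 y; lra.
  rewrite scalerDr !scalerA addrA [in LHS](dec y); congr (_ *: _ + _ *: _ + _ *: _).
    by field; rewrite gt_eqF.
  by field; rewrite gt_eqF.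
have := sum1 y => sy.
apply: (cD p) => //; last by apply/andP; split; lra.
by apply: cD => //; rewrite ler_pdivrMr// ler_pdivlMr// mul0r mul1r;
  apply/andP; split; lra.
Qed.

(** Without interior points D contains no proper triangle, hence lies on the line through [p] and
    [q]. The coordinate along this line, composed with [phi], would be a continuous injection of the
    disk into the reals. *)
Lemma jordan_domain_interior (D : set (R * R)) : jordan_domain D ->
  convex_comb_closed D -> exists c, interior D c.
Proof.
move=> [c [r r0 [phi [psi [[fphi iphi surj] _ cphi _]]]]] cD.
apply: contrapT => nint.
have cc : closed_disk c r c by rewrite /closed_disk/= subrr enorm0 ltW.
have cr : closed_disk c r (c + (r, 0)).
  rewrite /closed_disk/= addrC addKr (enorm_le _ (ltW r0)) /dotp/=.
  by rewrite mulr0 addr0 expr2.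
pose p := phi c; pose q := phi (c + (r, 0)).
have pq : q - p != 0.
  apply/eqP => /subr0_eq; rewrite /p /q => /iphi; rewrite !inE => /(_ cr cc).
  move=> /(congr1 fst)/= /eqP; rewrite -subr_eq0 addrC addKr => /eqP.
  by move=> h; rewrite h ltxx in r0.
have Dp : D p by exact: fphi.
have Dq : D q by exact: fphi.
have flat x : D x -> det3 p q x = 0.
  move=> Dx; apply/eqP; apply: contrapT => /negP d0.
  by apply: nint; apply: interior_of_triangle d0.
apply: (@closed_disk_no_injection c r (dotp (q - p) \o phi)) => //.
  apply: within_continuous_comp => // y _; exact: continuous_dotpr.
move=> x y; rewrite !inE => cx cy /= e; apply: iphi; rewrite ?inE//.
have dx := flat _ (fphi _ cx); have dy := flat _ (fphi _ cy).
pose v := q - p; rewrite -/v in e.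
have hv : dotp v v != 0 by apply/eqP => /dotp_eq0 h; rewrite -/v h eqxx in pq.
apply/subr0_eq; apply: (scalerI hv); rewrite scaler0.
have e1 : dotp (perp v) (phi x - phi y) = 0.
  by move: dx dy; rewrite /det3 -/v !dotpBr; lra.
have e2 : dotp v (phi x - phi y) = 0 by rewrite dotpBr e subrr.
(* For every z, [dotp v v *: z] is the sum of [dotp v z *: v] and [dotp (perp v) z *: perp v]; both
   coefficients vanish here. *)
move: e1 e2; case: (phi x - phi y) v {e hv} => a b [v1 v2].
rewrite /dotp /perp /= => e1 e2; congr pair; rewrite /= /GRing.scale/=.
  transitivity (v1 * (v1 * a + v2 * b) - v2 * (- v2 * a + v1 * b)); first by ring.
  by rewrite e1 e2; ring.
transitivity (v2 * (v1 * a + v2 * b) + v1 * (- v2 * a + v1 * b)); first by ring.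
by rewrite e1 e2; ring.
Qed.

Lemma compact_enorm_bounded (D : set (R * R)) : compact D ->
  exists2 K : R, 0 < K & forall p q, D p -> D q -> enorm (p - q) <= K.
Proof.
move=> cD; have [->|/set0P D0] := eqVneq D set0; first by exists 1.
have [c /set_mem Dc hc] :=
  compact_EVT_max D0 cD (continuous_subspaceT (@continuous_enorm R)).
exists (enorm c + enorm c + 1) => [|p q Dp Dq].
  by have := enorm_ge0 c; lra.
have := ler_enormD p (- q); rewrite enormN.
have := hc p (mem_set Dp); have := hc q (mem_set Dq); lra.
Qed.

End Disk.

(** * Supporting lines and nearest points *)

Section Clamp.
Context {R : realType}.

(** The nearest point of the interval from [a] to [b], written with absolute values so that
    continuity is immediate. *)
Definition clamp (a b t : R) : R := (`|t - a| - `|t - b| + a + b) / 2.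

Lemma clamp_itv (a b t : R) : a <= b -> a <= clamp a b t <= b.
Proof.
rewrite /clamp => ab; apply/andP.
by case: (ger0P (t - a)) => ?; case: (ger0P (t - b)) => ?; split; lra.
Qed.

Lemma clamp_id (a b t : R) : a <= t <= b -> clamp a b t = t.
Proof.
move=> /andP[ta tb]; rewrite /clamp.
by case: (ger0P (t - a)) => ?; case: (ger0P (t - b)) => ?; lra.
Qed.

Lemma continuous_clamp (a b : R) : continuous (clamp a b).
Proof.
have cn (d : R) : continuous (fun t : R => `|t - d|).
  move=> t; apply: (continuous_comp (cvgB cvg_id (cvg_cst d))).
  exact: norm_continuous.
move=> t; apply: (cvgM _ (cvg_cst _)); apply: (cvgD _ (cvg_cst _)).
apply: (cvgD _ (cvg_cst _)); exact: (cvgB (cn a t) (cn b t)).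
Qed.

End Clamp.

Section Normalize.
Context {R : realType}.

Definition normalize (p : R * R) : R * R := (enorm p)^-1 *: p.

Lemma enorm_gt0 (p : R * R) : p != 0 -> 0 < enorm p.
Proof.
move=> p0; rewrite lt_neqAle enorm_ge0 andbT eq_sym; apply: contra p0.
by move=> /eqP/enorm0_eq0 ->.
Qed.

Lemma enorm_normalize (p : R * R) : p != 0 -> enorm (normalize p) = 1.
Proof.
move=> /enorm_gt0 p0; rewrite /normalize enormZ ger0_norm ?invr_ge0 ?enorm_ge0//.
by rewrite mulVf// gt_eqF.
Qed.

Lemma continuous_normalize (T : topologicalType) (F : T -> R * R) (t : T) :
  {for t, continuous F} -> F t != 0 -> {for t, continuous (normalize \o F)}.
Proof.
move=> cF F0.
have ce : {for t, continuous (@enorm R \o F)} :=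
  continuous_comp cF (@continuous_enorm R _).
have e0 : (@enorm R \o F) t != 0 by rewrite /= gt_eqF// enorm_gt0.
exact: (cvgZ (cvgV e0 ce) cF).
Qed.

End Normalize.

(** * Supporting lines and their relation to the width *)

Section Support.
Context {R : realType}.
Implicit Types (D : set (R * R)) (n p q x : R * R).

(** A small move from [p] in direction [n] leaves D. *)
Lemma boundary_of_support D n p : D p -> n != 0 ->
  (forall x, D x -> dotp n (x - p) <= 0) -> boundary D p.
Proof.
move=> Dp n0 hn; split; first exact: subset_closure.
move=> /nbhs_enormP[e e0 he].
have n1 := enorm_normalize n0.
have hD : D (p + (e / 2) *: normalize n).
  apply: he; rewrite addrC addKr enormZ n1 mulr1 ger0_norm; lra.
have := hn _ hD; rewrite addrC addKr dotpZr /normalize dotpZr -enorm_sqr.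
have := enorm_gt0 n0 => np.
rewrite expr2 mulKf ?gt_eqF// => h.
have : 0 < e / 2 * enorm n by rewrite mulr_gt0//; lra.
by lra.
Qed.

Lemma chord_measurable D x n : closed D ->
  measurable [set t : R | D (x + t *: n)].
Proof.
move=> cD; apply: measurable_realfun.closed_measurable.
have -> : [set t : R | D (x + t *: n)] = (fun t : R => x + t *: n) @^-1` D by [].
apply: preimage_closed => // t _.
by apply: (cvgD (cvg_cst x)); apply: cvgZ; [exact: cvg_id | exact: cvg_cst].
Qed.

Lemma lebesgue_measure_segment (a b : R) : a <= b ->
  lebesgue_measure (`[a, b]%classic : set R) = (b - a)%:E.
Proof.
move=> ab; rewrite lebesgue_measure_itv/= lte_fin lt_neqAle ab andbT.
by case: eqVneq => [->|_] //=; rewrite ?subrr// EFinN.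
Qed.

(** The normal [n] of the strip is taken as the chord direction: [dotp n] is an arc length parameter
    on such a chord, so the chord is no longer than the strip is wide. *)
Lemma width_le_support D n p q : compact D -> D !=set0 -> enorm n = 1 ->
  (forall x, D x -> dotp n q <= dotp n x <= dotp n p) ->
  (width D <= (dotp n p - dotp n q)%:E)%E.
Proof.
move=> cD [x0 Dx0] n1 hn.
have clD : closed D by apply: compact_closed => //; exact: norm_hausdorff.
apply: ge_ereal_inf; exists (ereal_sup [set chord_length D x n | x in [set: R * R]]).
  by exists n.
apply: ge_ereal_sup => _ [x _ <-]; rewrite /chord_length.
have hpq : dotp n q - dotp n x <= dotp n p - dotp n x.
  by have /andP[] := hn _ Dx0; lra.
have -> : dotp n p - dotp n q = (dotp n p - dotp n x) - (dotp n q - dotp n x) by ring.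
rewrite -lebesgue_measure_segment//; apply: le_measure.
- by apply/mem_set; exact: chord_measurable.
- by apply/mem_set; exact: measurable_itv.
- move=> t /= /hn; rewrite dotpDr dotpZr (enorm_unit n1) mulr1 in_itv/=.
  by move=> /andP[? ?]; apply/andP; split; lra.
Qed.

Lemma enorm_le_path_length (a b : R) (g : R -> R * R) : a < b ->
  ((enorm (g b - g a))%:E <= path_length a b g)%E.
Proof.
move=> ab; apply: ereal_sup_ubound; exists [:: b]; first exact: itv_partition1.
by rewrite /polygonal_length big_nat1.
Qed.

End Support.

(** * Nearest point projection onto a compact convex set *)

Section Nearest.
Context {R : realType} (D : set (R * R)).
Hypotheses (cD : compact D) (D0 : D !=set0) (convD : convex_comb_closed D).

(** A point of D at minimal distance from [z] exists by compactness; the obtuse angle inequality is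
    the first-order condition for this minimum. *)
Lemma nearest_exists (z : R * R) : exists p, D p /\
  forall x, D x -> dotp (z - p) (x - p) <= 0.
Proof.
have cz : continuous (fun x : R * R => enorm (x - z)).
  move=> x; apply: (continuous_comp (cvgB cvg_id (cvg_cst z))).
  exact: continuous_enorm.
have [p /set_mem Dp hp] := compact_EVT_min D0 cD (continuous_subspaceT cz).
exists p; split=> // x Dx; rewrite leNgt; apply/negP => d0.
set d := dotp (z - p) (x - p) in d0.
set m := dotp (x - p) (x - p).
(* Comparing [p] with the point at fraction [k] of the way to [x], and dividing by [k]. *)
have key (k : R) : 0 < k <= 1 -> 2 * d <= k * m.
  move=> /andP[k0 k1].
  have := hp _ (mem_set (convD Dp Dx (introT andP (conj (ltW k0) k1)))).
  rewrite enorm_le ?enorm_ge0// enorm_sqr.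
  have -> : dotp ((1 - k) *: p + k *: x - z) ((1 - k) *: p + k *: x - z) =
      k * (k * m) - k * (2 * d) + dotp (p - z) (p - z).
    by rewrite /m /d /dotp /= /GRing.scale/=; ring.
  move=> h; have : k * (2 * d) <= k * (k * m) by lra.
  by rewrite ler_pM2l.
(* The choice [k = min (1, d / m)] gives [2 * d <= d] in both cases, against [0 < d]. *)
have [md|dm] := leP m d.
  by have := key 1; rewrite ltr01 lexx mul1r => /(_ isT); lra.
have m0 : 0 < m by lra.
have := key (d / m); rewrite divfK ?gt_eqF//.
by rewrite divr_gt0// ler_pdivrMr// mul1r (ltW dm) => /(_ isT); lra.
Qed.

Lemma nearest_point : exists pi : R * R -> R * R, (forall z, D (pi z)) /\
  forall z x, D x -> dotp (z - pi z) (x - pi z) <= 0.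
Proof.
have [pi hpi] := choice nearest_exists.
by exists pi; split=> [z|z x]; [exact: (hpi z).1 | exact: (hpi z).2].
Qed.

Variable pi : R * R -> R * R.
Hypotheses (Dpi : forall z, D (pi z))
  (piP : forall z x, D x -> dotp (z - pi z) (x - pi z) <= 0).

Lemma nearest_id a : D a -> pi a = a.
Proof.
move=> Da; apply/eqP; rewrite eq_sym -subr_eq0; apply/eqP/dotp_eq0/eqP.
by rewrite eq_le dotp_ge0 andbT; exact: piP.
Qed.

(** Adding the obtuse angle inequalities at [pi z] and [pi w] bounds the square of the left side by
    [dotp (z - w) (pi z - pi w)]; Cauchy-Schwarz finishes. *)
Lemma nearest_lipschitz z w : enorm (pi z - pi w) <= enorm (z - w).
Proof.
have [->|n0] := eqVneq (pi z - pi w) 0; first by rewrite enorm0 enorm_ge0.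
have n1 := enorm_gt0 n0.
rewrite -(ler_pM2r n1); apply: le_trans (cauchy_schwarz _ _).
rewrite -expr2 enorm_sqr -subr_le0 -dotpBl.
have h1 := piP z (Dpi w); have h2 := piP w (Dpi z).
have -> : dotp (pi z - pi w - (z - w)) (pi z - pi w) =
  dotp (z - pi z) (pi w - pi z) + dotp (w - pi w) (pi z - pi w).
  rewrite /dotp /=; ring.
by lra.
Qed.

Lemma continuous_nearest : continuous pi.
Proof. by apply: enorm_lipschitz_continuous => x y; exact: nearest_lipschitz. Qed.

End Nearest.

(** * Evading a short sensor curve *)

Section Evasion.
Context {R : realType} (D : set (R * R)) (c : R * R) (r K : R).
Hypotheses (cD : compact D) (convD : convex_comb_closed D) (r0 : 0 < r)
  (ballD : forall x, enorm (x - c) <= r -> D x) (K0 : 0 < K)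
  (diamD : forall p q, D p -> D q -> enorm (p - q) <= K).
Variable pi : R * R -> R * R.
Hypotheses (Dpi : forall z, D (pi z))
  (piP : forall z x, D x -> dotp (z - pi z) (x - pi z) <= 0).

Let Dc : D c.
Proof. by apply: ballD; rewrite subrr enorm0 ltW. Qed.

Let closedD : closed D.
Proof. by apply: compact_closed cD; exact: norm_hausdorff. Qed.

Let boundary_in p : boundary D p -> D p.
Proof. by move=> [/closedD]. Qed.

Variable eta : R.
Hypothesis eta0 : 0 < eta.

Definition outer (a : R * R) : R * R := a + eta *: (a - c).

Definition approx_normal (a : R * R) : R * R := outer a - pi (outer a).

(** Otherwise the homothety with centre [outer a] and ratio [eta / (1 + eta)], which sends [c] to
    [a], would carry the ball around [c] to a ball around [a] inside D. *)
Lemma outer_notin a : boundary D a -> ~ D (outer a).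
Proof.
move=> [_ nint] Dz; apply: nint; apply/nbhs_enormP.
have e1 : 0 < 1 + eta by rewrite addr_gt0.
exists (r * (eta / (1 + eta))); first by rewrite mulr_gt0// divr_gt0.
move=> q hq.
have hk : 0 <= eta / (1 + eta) <= 1.
  by rewrite ler_pdivrMr// divr_ge0 ?(ltW eta0) ?(ltW e1)//= mul1r lerDr.
have k0 : 0 < eta / (1 + eta) by rewrite divr_gt0.
have -> : q = (1 - eta / (1 + eta)) *: outer a +
    (eta / (1 + eta)) *: (c + (eta / (1 + eta))^-1 *: (q - a)).
  by apply: injective_projections; rewrite /outer /= /GRing.scale/=; field;
    rewrite !gt_eqF.
apply: convD => //; apply: ballD.
rewrite addrC addKr enormZ ger0_norm ?invr_ge0 ?(ltW k0)//.
by rewrite ler_pdivrMl// mulrC ltW.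
Qed.

Lemma approx_normal_neq0 a : boundary D a -> approx_normal a != 0.
Proof.
move=> ba; apply/eqP => /subr0_eq h; apply: (outer_notin ba); rewrite h; exact: Dpi.
Qed.

Lemma continuous_approx_normal : continuous approx_normal.
Proof.
have co : continuous outer.
  move=> a; apply: cvgD; first exact: cvg_id.
  by apply: cvgZ; [exact: cvg_cst | exact: (cvgB cvg_id (cvg_cst c))].
move=> a; apply: (cvgB (co a)).
exact: (continuous_comp (co a) (continuous_nearest Dpi piP (x := _))).
Qed.

Lemma enorm_outer_sub a : D a -> enorm (outer a - a) <= eta * K.
Proof.
move=> Da; rewrite /outer addrC addKr enormZ gtr0_norm// ler_pM2l//.
exact: diamD.
Qed.

Lemma enorm_nearest_outer a : D a -> enorm (pi (outer a) - a) <= eta * K.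
Proof.
move=> Da; rewrite -[X in _ - X](nearest_id piP Da).
exact: le_trans (nearest_lipschitz Dpi piP _ _) (enorm_outer_sub Da).
Qed.

(** Opposite normals give parallel supporting lines through [pi (outer a)] and [pi (outer b)]. These
    points are within [eta * K] of [a] and [b], whence the slack [2 * (eta * K)]. *)
Lemma normals_not_opposite a b (l : R) : boundary D a -> boundary D b ->
  enorm (a - b) <= l -> ((l + 2 * (eta * K))%:E < width D)%E ->
  normalize (approx_normal a) + normalize (approx_normal b) != 0.
Proof.
move=> ba bb hab hw; apply/eqP => h.
have hb : normalize (approx_normal b) = - normalize (approx_normal a).
  by apply/eqP; rewrite -addr_eq0 addrC h.
have sup d x : D x -> dotp (normalize (approx_normal d)) (x - pi (outer d)) <= 0.
  move=> Dx; rewrite /normalize dotpZl mulr_ge0_le0 ?invr_ge0 ?enorm_ge0//.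
  exact: piP.
have n1 := enorm_normalize (approx_normal_neq0 ba).
have : (width D <= (dotp (normalize (approx_normal a)) (pi (outer a)) -
    dotp (normalize (approx_normal a)) (pi (outer b)))%:E)%E.
  apply: width_le_support => //; first by exists c.
  move=> x Dx; have := sup a x Dx; have := sup b x Dx.
  by rewrite hb dotpNl !dotpBr; lra.
apply/negP; rewrite -ltNge; apply: le_lt_trans hw; rewrite lee_fin -dotpBr.
apply: le_trans (cauchy_schwarz _ _) _; rewrite n1 mul1r.
have := enorm_nearest_outer (boundary_in ba).
have := enorm_nearest_outer (boundary_in bb); rewrite enormB => h1 h2.
have -> : pi (outer a) - pi (outer b) =
   ((pi (outer a) - a) + (b - pi (outer b))) + (a - b).
  by apply: injective_projections => /=; ring.
have := ler_enormD ((pi (outer a) - a) + (b - pi (outer b))) (a - b).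
have := ler_enormD (pi (outer a) - a) (b - pi (outer b)).
by lra.
Qed.

(** Chosen so that [r * (M - K) = 2 * K ^+ 2 + r], which exceeds the bound [2 * K ^+ 2] reached in
    [far_point_neq]. It does not depend on [eta]. *)
Let M : R := K + 2 * K ^+ 2 / r + 1.

Definition far_point (u : R * R) : R * R := pi (c + M *: u).

Lemma far_point_gap u p : enorm u = 1 -> D p -> M - K <= enorm (c + M *: u - p).
Proof.
move=> u1 Dp.
have M0 : 0 <= M by rewrite /M !addr_ge0 ?mulr_ge0 ?invr_ge0 ?sqr_ge0 ?(ltW r0) ?(ltW K0).
have : enorm (M *: u) <= enorm (c + M *: u - p) + enorm (p - c).
  apply: le_trans (ler_enormD _ _).
  suff -> : c + M *: u - p + (p - c) = M *: u by [].
  by apply: injective_projections => /=; ring.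
rewrite enormZ ger0_norm// u1 mulr1; have := diamD Dp Dc; lra.
Qed.

Let MK : 0 < M - K.
Proof.
have : 0 <= 2 * K ^+ 2 / r by rewrite !mulr_ge0 ?invr_ge0 ?sqr_ge0 ?(ltW r0) ?(ltW K0).
by rewrite /M; lra.
Qed.

Lemma far_point_boundary u : enorm u = 1 -> boundary D (far_point u).
Proof.
move=> u1; apply: (@boundary_of_support _ _ (c + M *: u - far_point u)).
- exact: Dpi.
- apply/eqP => h; have := far_point_gap u1 (Dpi (c + M *: u)).
  by rewrite -/(far_point u) h enorm0; have := MK; lra.
- move=> x; exact: piP.
Qed.

(* Monotonicity of the normal cones: a point far out in direction u cannot
   carry a normal making an obtuse angle with u. *)
Lemma far_point_neq u a : enorm u = 1 -> boundary D a ->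
  dotp u (approx_normal a) <= 0 -> far_point u != a.
Proof.
move=> u1 ba un; apply/eqP => fa.
have Da := boundary_in ba.
pose nu := c + M *: u - a.
have nuP x : D x -> dotp nu (x - a) <= 0.
  by move=> Dx; have := piP (c + M *: u) Dx; rewrite -/(far_point u) fa.
have nuge : M - K <= enorm nu := far_point_gap u1 Da.
have nu0 : nu != 0.
  by apply/eqP => h; move: nuge; rewrite h enorm0; have := MK; lra.
(* The point of the ball around [c] lying furthest in direction [nu] is still behind the supporting
   line at [a] with normal [nu]. *)
have h1 : r * enorm nu <= dotp nu (a - c).
  have Dx : D (c + r *: normalize nu).
    by apply: ballD; rewrite addrC addKr enormZ (enorm_normalize nu0) mulr1 gtr0_norm.
  have e : c + r *: normalize nu - a = r *: normalize nu - (a - c).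
    by apply: injective_projections => /=; ring.
  have := nuP _ Dx; rewrite e (dotpBr _ _ (a - c)) dotpZr /normalize dotpZr.
  by rewrite -enorm_sqr expr2 mulKf ?gt_eqF ?enorm_gt0// subr_le0.
(* Since [pi (outer a)] is in D, it also lies behind that line. *)
have h2 : eta * dotp nu (a - c) <= dotp nu (approx_normal a).
  have := nuP _ (Dpi (outer a)).
  have -> : approx_normal a = eta *: (a - c) - (pi (outer a) - a).
    rewrite /approx_normal; set y := pi _.
    by apply: injective_projections; rewrite /outer /= /GRing.scale/=; ring.
  by rewrite (dotpBr nu (eta *: (a - c))) dotpZr; lra.
(* Split [nu] as [M *: u - (a - c)]: the first term contributes at most 0 by hypothesis, the second
   is bounded through the diameter. *)
have h3 : dotp nu (approx_normal a) <= K * (2 * (eta * K)).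
  have -> : dotp nu (approx_normal a) =
    M * dotp u (approx_normal a) - dotp (a - c) (approx_normal a).
    by rewrite /nu -dotpZl -dotpBl; congr dotp; apply: injective_projections => /=; ring.
  have : M * dotp u (approx_normal a) <= 0.
    by rewrite mulr_ge0_le0//; have := MK; have := K0; lra.
  have := cauchy_schwarzN (a - c) (approx_normal a).
  have : enorm (a - c) * enorm (approx_normal a) <= K * (2 * (eta * K)).
    apply: ler_pM; rewrite ?enorm_ge0//; first exact: diamD.
    have -> : approx_normal a = (outer a - a) + (a - pi (outer a)).
      by rewrite /approx_normal addrA subrK.
    apply: le_trans (ler_enormD _ _) _.
    have := enorm_outer_sub Da; have := enorm_nearest_outer Da; rewrite enormB.
    by lra.
  by lra.
(* Both sides carry a factor [eta]; after cancelling it, [M - K <= enorm nu] contradicts the choice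
   of [M]. *)
have h4 : eta * (r * enorm nu) <= eta * (2 * K ^+ 2).
  apply: le_trans (_ : _ <= eta * dotp nu (a - c)) _; first by rewrite ler_pM2l.
  suff -> : eta * (2 * K ^+ 2) = K * (2 * (eta * K)) by exact: le_trans h2 h3.
  by ring.
rewrite ler_pM2l// in h4.
have : r * (M - K) <= 2 * K ^+ 2 by apply: le_trans h4; rewrite ler_pM2l.
have -> : r * (M - K) = 2 * K ^+ 2 + r by rewrite /M; field; rewrite gt_eqF.
by have := r0; lra.
Qed.

(** The direction [U t] makes no acute angle with either normal, because the inner product of two
    unit vectors is at least -1; [far_point_neq] then applies to both ends. *)
Lemma evader (a b : R -> R * R) (l : R) : continuous a -> continuous b ->
  (forall t, boundary D (a t)) -> (forall t, boundary D (b t)) ->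
  (forall t, enorm (a t - b t) <= l) ->
  ((l + 2 * (eta * K))%:E < width D)%E ->
  exists g : R -> R * R, [/\ continuous g, forall t, boundary D (g t),
    forall t, g t != a t & forall t, g t != b t].
Proof.
move=> ca cb ba bb hab hw.
pose na t := normalize (approx_normal (a t)).
pose nb t := normalize (approx_normal (b t)).
pose U t := - (na t + nb t).
have U0 t : U t != 0 by rewrite oppr_eq0; exact: normals_not_opposite hw.
have cna t : {for t, continuous na}.
  exact: (@continuous_normalize _ _ (approx_normal \o a) t
    (continuous_comp (ca t) (@continuous_approx_normal _))
    (approx_normal_neq0 (ba t))).
have cnb t : {for t, continuous nb}.
  exact: (@continuous_normalize _ _ (approx_normal \o b) t
    (continuous_comp (cb t) (@continuous_approx_normal _))
    (approx_normal_neq0 (bb t))).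
have cU t : {for t, continuous U} by exact: (cvgN (cvgD (cna t) (cnb t))).
have u1 t : enorm (normalize (U t)) = 1 := enorm_normalize (U0 t).
have na1 t : enorm (na t) = 1 := enorm_normalize (approx_normal_neq0 (ba t)).
have nb1 t : enorm (nb t) = 1 := enorm_normalize (approx_normal_neq0 (bb t)).
have obtuse t d : dotp (U t) (normalize (approx_normal d)) <= 0 ->
    boundary D d -> dotp (normalize (U t)) (approx_normal d) <= 0.
  move=> h bd; have := enorm_gt0 (approx_normal_neq0 bd) => n0.
  move: h; rewrite /normalize dotpZr dotpZl pmulr_rle0 ?invr_gt0// => h.
  by rewrite mulr_ge0_le0// invr_ge0 enorm_ge0.
exists (fun t => far_point (normalize (U t))); split.
- move=> t.
  have c1 : {for t, continuous (normalize \o U)} := continuous_normalize (cU t) (U0 t).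
  have c2 : {for t, continuous (fun s => c + M *: (normalize \o U) s)}.
    exact: (cvgD (cvg_cst c) (cvgZ (cvg_cst M) c1)).
  exact: (continuous_comp c2 (continuous_nearest Dpi piP (x := _))).
- by move=> t; exact: far_point_boundary.
- move=> t; apply: far_point_neq => //; apply: obtuse => //.
  rewrite -/(na t) /U dotpNl dotpDl (enorm_unit (na1 t)).
  by have := cauchy_schwarzN (nb t) (na t); rewrite na1 nb1 mulr1; lra.
- move=> t; apply: far_point_neq => //; apply: obtuse => //.
  rewrite -/(nb t) /U dotpNl dotpDl (enorm_unit (nb1 t)).
  by have := cauchy_schwarzN (na t) (nb t); rewrite na1 nb1 mulr1; lra.
Qed.

End Evasion.

(** * The width is a lower bound for the length of every sweep *)

Section LowerBound.
Context {R : realType} (D : set (R * R)).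
Hypotheses (cD : compact D) (convD : convex_comb_closed D).

Lemma interior_ball : (exists c, interior D c) ->
  exists c, exists2 r : R, 0 < r & forall x, enorm (x - c) <= r -> D x.
Proof.
move=> [c /nbhs_enormP[e e0 he]]; exists c, (e / 2); first lra.
by move=> x hx; apply: he; apply: le_lt_trans hx _; lra.
Qed.

Lemma width_le_sensor_length (f : R * R -> R * R) : (exists c, interior D c) ->
  sweep D f -> (width D <= sensor_length f)%E.
Proof.
move=> /interior_ball[c [r r0 ballD]] [[fc fD _ _ [p0 bp0 fp0] [p1 bp1 fp1] fb] sw].
have [K K0 diamD] := compact_enorm_bounded cD.
have Dne : D !=set0 by exists c; apply: ballD; rewrite subrr enorm0 ltW.
have [pi [Dpi piP]] := nearest_point cD Dne convD.
have I0 : unit_itv R 0 by rewrite /unit_itv /= in_itv/= lexx ler01.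
have I1 : unit_itv R 1 by rewrite /unit_itv /= in_itv/= lexx ler01.
(* Clamping the time extends the end paths of the curves continuously to the whole line, while
   keeping their values on the boundary. *)
pose cl : R -> R := clamp 0 1.
have Icl t : unit_itv R (cl t).
  by rewrite /unit_itv /= in_itv/=; apply: clamp_itv; exact: ler01.
have clid t : unit_itv R t -> cl t = t.
  by rewrite /unit_itv /= in_itv/= => /clamp_id.
have side (s : R) : unit_itv R s -> continuous (fun t => f (s, cl t)).
  move=> Is.
  have cs : continuous (fun t : R => (s, cl t)).
    by move=> t; exact: (cvg_pair (cvg_cst s) (@continuous_clamp _ 0 1 t)).
  apply: (continuous_precomp (B := unit_itv R `*` unit_itv R) cs _ fc).
  by move=> t _; split => /=.
pose a t := f (0, cl t); pose b t := f (1, cl t).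
have ba t : boundary D (a t) by apply/fb => //; left; left.
have bb t : boundary D (b t) by apply/fb => //; left; right.
have dist t : ((enorm (b t - a t))%:E <= sensor_length f)%E.
  apply: (le_trans (enorm_le_path_length (fun s => f (s, cl t)) (@ltr01 R))).
  by apply: ereal_sup_ubound; exists (cl t).
apply/lee_addgt0Pr => e e0; rewrite leNgt; apply/negP => hw.
have L0 : (0 <= sensor_length f)%E.
  by apply: le_trans (dist 0); rewrite lee_fin enorm_ge0.
(* An infinite length would contradict [hw], so the real number [l] can replace it. *)
have Lfin : sensor_length f \is a fin_num.
  rewrite ge0_fin_numE//; rewrite ltNge leye_eq; apply/negP => /eqP h.
  by move: hw; rewrite h addye// ltNge leey.
rewrite -(fineK Lfin) in dist hw.
set l := fine _ in dist hw.
(* This makes the slack [2 * (eta * K)] in [evader] equal to the gap [e]. *)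
pose eta := e / (2 * K).
have eta0 : 0 < eta by rewrite divr_gt0// mulr_gt0.
have hw' : ((l + 2 * (eta * K))%:E < width D)%E.
  suff -> : 2 * (eta * K) = e by [].
  by rewrite /eta; field; rewrite gt_eqF.
have hab t : enorm (a t - b t) <= l by rewrite enormB -lee_fin.
have [g [cg gb ga gbb]] := evader cD convD r0 ballD K0 diamD Dpi piP eta0
  (side 0 I0) (side 1 I1) ba bb hab hw'.
have closedD : closed D by apply: compact_closed cD; exact: norm_hausdorff.
have gD : set_fun (unit_itv R) D g by move=> t _; have [/closedD] := gb t.
have [t It [s Is e1]] := sw g (continuous_subspaceT cg) gD.
have tcl := clid t It.
have : boundary D (f (s, t)) by rewrite e1.
(* The evader runs on the boundary, so it can only be caught at an end of a curve or at time 0 or 1.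
   At those times the curve is a single point, equal to its own start [a t]. *)
move/fb => /(_ Is It) -[[s0|s1]|[t0|t1]].
- by move: (ga t); rewrite -e1 s0 tcl eqxx.
- by move: (gbb t); rewrite -e1 s1 tcl eqxx.
- by move: (ga t); rewrite -e1 tcl t0 (fp0 _ Is) (fp0 _ I0) eqxx.
- by move: (ga t); rewrite -e1 tcl t1 (fp1 _ Is) (fp1 _ I0) eqxx.
Qed.

End LowerBound.

(** * Sweeping by parallel chords *)

Section ChordEndpoint.
Context {R : realType} (D : set (R * R)) (u v : R * R) (P0 P1 : R * R).
Hypotheses (cD : compact D) (convD : convex_comb_closed D) (D0 : D P0) (D1 : D P1).
Let y0 := dotp u P0.
Let y1 := dotp u P1.

(** One end of the chord at height [y]; replacing [v] by [- v] gives the other end. *)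
Definition chord_end (y : R) (p : R * R) := [/\ D p, dotp u p = y &
  forall x, D x -> dotp u x = y -> dotp v p <= dotp v x].

Lemma convex_comb_of_itv (a b y : R) : a <= y <= b \/ b <= y <= a ->
  exists2 k : R, 0 <= k <= 1 & y = (1 - k) * a + k * b.
Proof.
have [->|ab] := eqVneq a b.
  by move=> h; exists 0; [rewrite lexx ler01 | case: h => /andP[]; lra].
move=> h; exists ((y - a) / (b - a)); last first.
  by field; rewrite subr_eq0 eq_sym.
case: h => /andP[h1 h2].
  have ba : 0 < b - a by rewrite subr_gt0 lt_neqAle ab (le_trans h1 h2).
  by rewrite ler_pdivrMr// divr_ge0 ?(ltW ba) ?subr_ge0//= mul1r lerD2r.
have ba : 0 < a - b by rewrite subr_gt0 lt_neqAle eq_sym ab (le_trans h1 h2).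
rewrite -(opprB a y) -(opprB a b) invrN mulrNN.
by rewrite ler_pdivrMr// divr_ge0 ?(ltW ba) ?subr_ge0//= mul1r lerD2l lerN2.
Qed.

Lemma chord_end_exists (y : R) : y0 <= y <= y1 -> exists p, chord_end y p.
Proof.
move=> hy.
have [k k01 yk] := convex_comb_of_itv (or_introl hy).
pose E := D `&` dotp u @^-1` [set y].
have cE : compact E.
  apply: (subclosed_compact _ cD) => [|x []//].
  apply: closedI; first by apply: compact_closed cD; exact: norm_hausdorff.
  apply: preimage_closed; last exact: closed_eq.
  by move=> x _; exact: continuous_dotpr.
have E0 : E !=set0.
  exists ((1 - k) *: P0 + k *: P1); split; first exact: convD.
  by rewrite /= dotpDr !dotpZr -/y0 -/y1 -yk.
have [p /set_mem[Dp hp] pmin] :=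
  compact_EVT_min E0 cE (continuous_subspaceT (@continuous_dotpr R v)).
by exists p; split => // x Dx hx; apply: pmin; exact/mem_set.
Qed.

Variable L : R -> R * R.
Hypothesis LP : forall y, y0 <= y <= y1 -> chord_end y (L y).

(** As a function of the height, [dotp v (L y)] is convex. For [y'] between [y] and [e1], the weight
    [k] of [e1] satisfies [k * K < e] by the distance hypothesis; the alternative [e1 = y] is the
    degenerate case at an end of the interval. *)
Lemma chord_end_usc (K e y e1 y' : R) : 0 < e ->
  (forall p q, D p -> D q -> dotp v p - dotp v q <= K) -> 0 < K ->
  y0 <= y <= y1 -> y0 <= e1 <= y1 ->
  y <= y' <= e1 \/ e1 <= y' <= y -> `|y - y'| * K < e * `|e1 - y| \/ e1 = y ->
  dotp v (L y') < dotp v (L y) + e.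
Proof.
move=> e0 hK K0 hy he1 hb hd.
have [k /andP[k0 k1] yk] := convex_comb_of_itv hb.
have [Dy uy vy] := LP hy; have [De ue ve] := LP he1.
have hy' : y0 <= y' <= y1.
  by move: hy he1 hb => /andP[? ?] /andP[? ?] [/andP[? ?]|/andP[? ?]];
    apply/andP; split; lra.
have [_ _ vy'] := LP hy'.
have h : dotp v (L y') <= (1 - k) * dotp v (L y) + k * dotp v (L e1).
  rewrite -!dotpZr -dotpDr; apply: vy'; first by apply: convD => //; rewrite k0 k1.
  by rewrite dotpDr !dotpZr uy ue yk.
have := hK _ _ De Dy => hK1.
case: hd => [hd|ey]; last first.
  have -> : y' = y by rewrite yk ey; ring.
  lra.
have kK : k * K < e.
  have n0 : 0 < `|e1 - y|.
    rewrite normr_gt0 subr_eq0; apply/eqP => ey; move: hd; rewrite ey subrr normr0 mulr0.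
    by rewrite ltNge mulr_ge0// ltW.
  rewrite -(ltr_pM2r n0); apply: le_lt_trans hd.
  have -> : y - y' = - (k * (e1 - y)) by rewrite yk; ring.
  by rewrite normrN normrM (ger0_norm k0) mulrAC.
have : k * (dotp v (L e1) - dotp v (L y)) <= k * K by rewrite ler_wpM2l.
by lra.
Qed.

(** Compactness of D: the heights of points whose [v] coordinate is at most [dotp v (L y) - e] form
    a closed set, which misses [y]. *)
Lemma chord_end_lsc (e y : R) : 0 < e -> y0 <= y <= y1 ->
  \forall y' \near y, y0 <= y' <= y1 -> dotp v (L y) - e < dotp v (L y').
Proof.
move=> e0 hy.
pose S := dotp u @` (D `&` dotp v @^-1` [set z | z <= dotp v (L y) - e]).
have cS : closed S.
  apply: compact_closed; first exact: norm_hausdorff.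
  apply: continuous_compact; first exact: continuous_subspaceT (@continuous_dotpr R u).
  apply: (subclosed_compact _ cD) => [|x []//].
  apply: closedI; first by apply: compact_closed cD; exact: norm_hausdorff.
  apply: preimage_closed; last exact: closed_le.
  by move=> x _; exact: continuous_dotpr.
have nS : nbhs y (~` S).
  apply: open_nbhs_nbhs; split; first exact: closed_openC.
  move=> [x [Dx /= gx] ux]; have [_ _ ymin] := LP hy.
  by have := ymin x Dx ux; lra.
apply: filterS nS => y' nSy' hy'; rewrite ltNge; apply/negP => h.
by apply: nSy'; have [Dl ul _] := LP hy'; exists (L y').
Qed.

Lemma chord_end_continuous : {within `[y0, y1], continuous (dotp v \o L)}.
Proof.
have [K' K'0 hK'] := compact_enorm_bounded cD.
pose K := enorm v * K' + 1.
have K0 : 0 < K by rewrite ltr_wpDl// mulr_ge0 ?enorm_ge0// ltW.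
have hK p q : D p -> D q -> dotp v p - dotp v q <= K.
  move=> Dp Dq; rewrite -dotpBr; apply: le_trans (cauchy_schwarz _ _) _.
  have : enorm v * enorm (p - q) <= enorm v * K'.
    by rewrite ler_wpM2l ?enorm_ge0//; exact: hK'.
  by rewrite /K; lra.
apply/subspace_continuousP => y; rewrite /= in_itv/= => hy.
apply/cvgrPdist_lt => e e0.
(* To be used towards both ends, [e1 = y0] and [e1 = y1], so that together they cover all nearby
   heights in the interval. *)
have usc (e1 : R) : y0 <= e1 <= y1 -> \forall y' \near y,
    y <= y' <= e1 \/ e1 <= y' <= y -> dotp v (L y') < dotp v (L y) + e.
  move=> he1; have [ey|ney] := eqVneq e1 y.
    apply/nbhs_ballP; exists 1 => //= y' _ hb.
    by apply: (chord_end_usc e0 hK K0 hy he1 hb); right.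
  have d0 : 0 < e * `|e1 - y| / K.
    by rewrite divr_gt0// mulr_gt0// normr_gt0 subr_eq0.
  apply/nbhs_ballP; exists (e * `|e1 - y| / K) => // y' hd hb.
  apply: (chord_end_usc e0 hK K0 hy he1 hb); left.
  by move: hd; rewrite -ball_normE/= ltr_pdivlMr.
have yle : y0 <= y1 by case/andP: hy; exact: le_trans.
have n0 := usc y0; have n1 := usc y1; rewrite !lexx yle/= in n0 n1.
have nl := chord_end_lsc e0 hy.
rewrite near_withinE; apply: filterS (filterI (n0 isT) (filterI (n1 isT) nl)).
move=> y' [a0 [a1 al]] /=; rewrite in_itv/= => hy'.
have {}al := al hy'.
have au : dotp v (L y') < dotp v (L y) + e.
  move: hy' => /andP[h0 h1].
  have [h|/ltW h] := leP y y'; first by apply: a1; left; rewrite h h1.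
  by apply: a0; right; rewrite h h0.
by rewrite ltr_distlC /=; apply/andP.
Qed.

End ChordEndpoint.

Section PathLength.
Context {R : realType}.

Lemma sum_partition_segment (b : R) (p d : R * R) (s : seq R) (a : R) :
  path <%O a s ->
  \sum_(0 <= n < size s) enorm ((p + nth b (a :: s) n.+1 *: d) -
     (p + nth b (a :: s) n *: d)) = (last a s - a) * enorm d.
Proof.
elim: s a => [|x s ih] a /=; first by rewrite big_geq// subrr mul0r.
move=> /andP[ax xs]; rewrite big_nat_recl//= ih//.
have -> : p + x *: d - (p + a *: d) = (x - a) *: d.
  by apply: injective_projections; rewrite /= /GRing.scale/=; ring.
by rewrite enormZ gtr0_norm ?subr_gt0//; ring.
Qed.

Lemma path_length_segment (p d : R * R) :
  (path_length 0 1 (fun s : R => p + s *: d)%R <= (enorm d)%:E)%E.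
Proof.
apply: ge_ereal_sup => _ [s [ps /eqP ls] <-]; rewrite lee_fin /polygonal_length/=.
by rewrite (sum_partition_segment 1 p d ps) ls subr0 mul1r.
Qed.

End PathLength.

(** * The sweep by parallel chords shrinking to the points P0 and P1 *)

Section ChordSweep.
Context {R : realType} (D : set (R * R)) (v : R * R) (P0 P1 c : R * R) (r : R).
Hypotheses (cD : compact D) (convD : convex_comb_closed D) (v1 : enorm v = 1)
  (D0 : D P0) (D1 : D P1) (r0 : 0 < r)
  (ballD : forall x, enorm (x - c) <= r -> D x).
Let u := perp v.
Hypotheses (min0 : forall x, D x -> dotp u x <= dotp u P0 -> x = P0)
  (max1 : forall x, D x -> dotp u P1 <= dotp u x -> x = P1).
Let y0 := dotp u P0.
Let y1 := dotp u P1.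

Let u1 : dotp u u = 1.
Proof. by apply: enorm_unit; rewrite enorm_perp. Qed.

Let uv : dotp u v = 0.
Proof. exact: perp_orth. Qed.

Let vv : dotp v v = 1.
Proof. exact: enorm_unit. Qed.

Let dec x : x = dotp u x *: u + dotp v x *: v.
Proof. exact: orth_decomp. Qed.

Let y_range x : D x -> y0 <= dotp u x <= y1.
Proof.
move=> Dx; apply/andP; split; rewrite leNgt; apply/negP => h.
  by have e := min0 Dx (ltW h); move: h; rewrite e ltxx.
by have e := max1 Dx (ltW h); move: h; rewrite e ltxx.
Qed.

Let ball_pt (k : R) (w : R * R) : enorm w = 1 -> `|k| <= r -> D (c + k *: w).
Proof. by move=> w1 kr; apply: ballD; rewrite addrC addKr enormZ w1 mulr1. Qed.

Let yc := dotp u c.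

Let yc_range : y0 < yc < y1.
Proof.
have un : enorm u = 1 by rewrite enorm_perp.
have /y_range/andP[_] : D (c + r *: u) by apply: ball_pt; rewrite ?gtr0_norm.
have /y_range/andP[+ _] : D (c + (- r) *: u).
  by apply: ball_pt; rewrite ?normrN ?gtr0_norm.
rewrite !dotpDr !dotpZr u1 -/yc => h1 h2; have := r0 => rr.
by apply/andP; split; lra.
Qed.

Let y01 : y0 < y1.
Proof. by case/andP: yc_range; exact: lt_trans. Qed.

Variables left right : R -> R * R.
Hypotheses
  (leftP : forall y, y0 <= y <= y1 -> chord_end D u v y (left y))
  (rightP : forall y, y0 <= y <= y1 -> chord_end D u (- v) y (right y)).

Let chord_le x : D x ->
  dotp v (left (dotp u x)) <= dotp v x <= dotp v (right (dotp u x)).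
Proof.
move=> Dx; have [_ _ hl] := leftP (y_range Dx); have [_ _ hr] := rightP (y_range Dx).
by rewrite hl//=; have := hr x Dx erefl; rewrite !dotpNl lerN2.
Qed.

Definition chord_width (y : R) := dotp v (right y) - dotp v (left y).

Lemma chord_vector (y : R) : y0 <= y <= y1 ->
  right y - left y = chord_width y *: v.
Proof.
move=> hy; have [_ ul _] := leftP hy; have [_ ur _] := rightP hy.
rewrite [right y]dec [left y]dec ul ur /chord_width.
by apply: injective_projections => /=; rewrite /GRing.scale/=; ring.
Qed.

Lemma chord_width_ge0 (y : R) : y0 <= y <= y1 -> 0 <= chord_width y.
Proof.
move=> hy; have [Dl ul _] := leftP hy; rewrite subr_ge0.
by have := chord_le Dl; rewrite ul => /andP[].
Qed.

(** Contracting the ball around [c] towards [P0] or [P1] leaves, at each intermediate height, a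
    segment of half-length [k * r] in direction [v] inside D. *)
Lemma chord_width_gt0 (y : R) : y0 < y < y1 -> 0 < chord_width y.
Proof.
have key P k z : D P -> 0 < k <= 1 -> z = (1 - k) * dotp u P + k * yc ->
    0 < chord_width z.
  move=> DP /andP[k0 k1] hz.
  have mem e : `|e| <= r -> D ((1 - k) *: P + k *: (c + e *: v)).
    by move=> er; apply: convD => //; [exact: ball_pt | rewrite ltW].
  have hu e : dotp u ((1 - k) *: P + k *: (c + e *: v)) = z.
    by rewrite !(dotpDr, dotpZr) uv hz -/yc; ring.
  have rr := r0.
  have /chord_le/andP[_] : D ((1 - k) *: P + k *: (c + r *: v)).
    by apply: mem; rewrite gtr0_norm.
  have /chord_le/andP[+ _] : D ((1 - k) *: P + k *: (c + (- r) *: v)).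
    by apply: mem; rewrite normrN gtr0_norm.
  rewrite !hu !(dotpDr, dotpZr) vv /chord_width => h1 h2.
  have : 0 < k * r by rewrite mulr_gt0.
  by lra.
move=> /andP[hy0 hy1]; have /andP[c0 c1] := yc_range.
have [h|/ltW h] := leP y yc.
  have d0 : 0 < yc - y0 by rewrite subr_gt0.
  apply: (key P0 ((y - y0) / (yc - y0))) => //.
    by rewrite divr_gt0 ?subr_gt0// ler_pdivrMr// mul1r lerD2r.
  by rewrite -/y0; field; rewrite gt_eqF.
have d0 : 0 < y1 - yc by rewrite subr_gt0.
apply: (key P1 ((y1 - y) / (y1 - yc))) => //.
  by rewrite divr_gt0 ?subr_gt0// ler_pdivrMr// mul1r lerD2l lerN2.
by rewrite -/y1; field; rewrite gt_eqF.
Qed.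

Lemma on_chord x : y0 <= dotp u x <= y1 ->
  dotp v (left (dotp u x)) <= dotp v x <= dotp v (right (dotp u x)) ->
  exists2 s : R, 0 <= s <= 1 &
    x = left (dotp u x) + s *: (right (dotp u x) - left (dotp u x)).
Proof.
move=> hy /andP[hl hr]; set y := dotp u x in hy hl hr *.
have [_ ul _] := leftP hy.
have w0 := chord_width_ge0 hy.
have [s s01 hs] : exists2 s : R, 0 <= s <= 1 &
    dotp v x = dotp v (left y) + s * chord_width y.
  have [w00|wn] := eqVneq (chord_width y) 0.
    exists 0; first by rewrite lexx ler01.
    by move: w00; rewrite /chord_width => w00; lra.
  have wp : 0 < chord_width y by rewrite lt_neqAle eq_sym wn.
  exists ((dotp v x - dotp v (left y)) / chord_width y); last first.
    by rewrite divfK//; ring.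
  apply/andP; split; first by rewrite divr_ge0// subr_ge0.
  by rewrite ler_pdivrMr// mul1r /chord_width lerD2r.
exists s => //; rewrite chord_vector//.
rewrite [in LHS](dec x) [left y]dec ul hs -/y.
by apply: injective_projections => /=; rewrite /GRing.scale/=; ring.
Qed.

Let height (t : R) := y0 + t * (y1 - y0).

Let height_itv t : 0 <= t <= 1 -> y0 <= height t <= y1.
Proof.
move=> /andP[t0 t1]; have d : 0 <= y1 - y0 by rewrite subr_ge0 ltW.
have : 0 <= t * (y1 - y0) by rewrite mulr_ge0.
have : t * (y1 - y0) <= 1 * (y1 - y0) by rewrite ler_wpM2r.
by rewrite /height => h1 h2; apply/andP; split; lra.
Qed.

Let height_lt t : 0 < t < 1 -> y0 < height t < y1.
Proof.
move=> /andP[t0 t1]; have d : 0 < y1 - y0 by rewrite subr_gt0.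
have : 0 < t * (y1 - y0) by rewrite mulr_gt0.
have : t * (y1 - y0) < 1 * (y1 - y0) by rewrite ltr_pM2r.
by rewrite /height => h1 h2; apply/andP; split; lra.
Qed.

(** Clamped heights make the chord ends continuous on the whole line, as needed for neighbourhood
    arguments in the plane. *)
Let lft (y : R) := left (clamp y0 y1 y).
Let rgt (y : R) := right (clamp y0 y1 y).

Definition chord_sweep (p : R * R) : R * R :=
  lft (height p.2) + p.1 *: (rgt (height p.2) - lft (height p.2)).

Lemma chord_sweepE (s t : R) : 0 <= t <= 1 -> chord_sweep (s, t) =
  left (height t) + s *: (right (height t) - left (height t)).
Proof. by move=> /height_itv ht; rewrite /chord_sweep /lft /rgt /= clamp_id. Qed.

Lemma dotp_chord_sweep (s t : R) : 0 <= t <= 1 ->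
  dotp u (chord_sweep (s, t)) = height t.
Proof.
move=> ht; rewrite chord_sweepE// chord_vector ?height_itv//.
have [_ ul _] := leftP (height_itv ht).
by rewrite dotpDr !dotpZr uv ul !mulr0 addr0.
Qed.

Lemma dotv_chord_sweep (s t : R) : 0 <= t <= 1 ->
  dotp v (chord_sweep (s, t)) = dotp v (left (height t)) + s * chord_width (height t).
Proof.
move=> ht; rewrite chord_sweepE// chord_vector ?height_itv//.
by rewrite dotpDr !dotpZr vv mulr1.
Qed.

Let continuous_vlft : continuous (fun y => dotp v (lft y)).
Proof.
have c1 := chord_end_continuous cD convD leftP.
apply: (continuous_precomp (@continuous_clamp R y0 y1) _ c1).
by move=> y _ /=; rewrite in_itv/=; apply: clamp_itv; exact: ltW.
Qed.

Let continuous_vrgt : continuous (fun y => dotp v (rgt y)).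
Proof.
have c1 := chord_end_continuous cD convD rightP.
have c2 : continuous ((dotp (- v) \o right) \o clamp y0 y1).
  apply: (continuous_precomp (@continuous_clamp R y0 y1) _ c1).
  by move=> y _ /=; rewrite in_itv/=; apply: clamp_itv; exact: ltW.
have -> : (fun y => dotp v (rgt y)) =
    (fun y => - ((dotp (- v) \o right) \o clamp y0 y1) y).
  by apply/funext => y; rewrite /= dotpNl opprK.
by move=> y; apply: cvgN; exact: c2.
Qed.

Let clampP (y : R) : y0 <= clamp y0 y1 y <= y1.
Proof. by apply: clamp_itv; exact: ltW. Qed.

Let continuous_lft : continuous lft.
Proof.
have -> : lft = fun y => clamp y0 y1 y *: u + dotp v (lft y) *: v.
  apply/funext => y; rewrite [lft y in LHS]dec.
  by have [_ -> _] := leftP (clampP y).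
move=> y; apply: cvgD; apply: cvgZ; try exact: cvg_cst.
  exact: continuous_clamp.
exact: continuous_vlft.
Qed.

Let continuous_rgt : continuous rgt.
Proof.
have -> : rgt = fun y => clamp y0 y1 y *: u + dotp v (rgt y) *: v.
  apply/funext => y; rewrite [rgt y in LHS]dec.
  by have [_ -> _] := rightP (clampP y).
move=> y; apply: cvgD; apply: cvgZ; try exact: cvg_cst.
  exact: continuous_clamp.
exact: continuous_vrgt.
Qed.

Let continuous_height : continuous height.
Proof.
move=> t; apply: (cvgD (cvg_cst y0)).
exact: (cvgM cvg_id (cvg_cst (y1 - y0))).
Qed.

Lemma continuous_chord_sweep : continuous chord_sweep.
Proof.
move=> p.
have ch : {for p, continuous (height \o snd)} :=
  continuous_comp (@continuous_snd R p) (@continuous_height _).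
have cl : {for p, continuous (lft \o (height \o snd))} :=
  continuous_comp ch (@continuous_lft _).
have cr : {for p, continuous (rgt \o (height \o snd))} :=
  continuous_comp ch (@continuous_rgt _).
exact: (cvgD cl (cvgZ (@continuous_fst R p) (cvgB cr cl))).
Qed.

Lemma chord_sweep_in (s t : R) : 0 <= s <= 1 -> 0 <= t <= 1 -> D (chord_sweep (s, t)).
Proof.
move=> hs ht; rewrite chord_sweepE//.
have [Dl _ _] := leftP (height_itv ht); have [Dr _ _] := rightP (height_itv ht).
suff -> : left (height t) + s *: (right (height t) - left (height t)) =
    (1 - s) *: left (height t) + s *: right (height t) by exact: convD.
by apply: injective_projections => /=; rewrite /GRing.scale/=; ring.
Qed.

(** Four strict inequalities, two on the height and two on the position along the chord, persist
    near the point by continuity, and every point satisfying them lies on a chord of D. *)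
Lemma chord_sweep_interior (s t : R) : 0 < s < 1 -> 0 < t < 1 ->
  interior D (chord_sweep (s, t)).
Proof.
move=> hs ht; set p := chord_sweep (s, t).
have ht' : 0 <= t <= 1 by case/andP: ht => a b; rewrite !ltW.
have up : dotp u p = height t by exact: dotp_chord_sweep.
have vp := dotv_chord_sweep s ht'; rewrite -/p in vp.
have /andP[h0 h1] := height_lt ht.
have w0 : 0 < chord_width (height t) by apply: chord_width_gt0; rewrite h0 h1.
have cu : {for p, continuous (dotp u)} := @continuous_dotpr R u p.
have cv : {for p, continuous (dotp v)} := @continuous_dotpr R v p.
have cl : {for p, continuous (fun x => dotp v x - dotp v (lft (dotp u x)))}.
  exact: (cvgB cv (continuous_comp cu (@continuous_vlft _))).
have cr : {for p, continuous (fun x => dotp v (rgt (dotp u x)) - dotp v x)}.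
  exact: (cvgB (continuous_comp cu (@continuous_vrgt _)) cv).
have lp : lft (dotp u p) = left (height t) by rewrite up /lft clamp_id ?height_itv.
have rp : rgt (dotp u p) = right (height t) by rewrite up /rgt clamp_id ?height_itv.
case/andP: hs => s0 s1.
have b0 : y0 < dotp u p by rewrite up.
have b1 : dotp u p < y1 by rewrite up.
have b2 : 0 < dotp v p - dotp v (lft (dotp u p)).
  by rewrite lp vp addrC addKr mulr_gt0.
have b3 : 0 < dotp v (rgt (dotp u p)) - dotp v p.
  rewrite rp vp.
  have : 0 < (1 - s) * chord_width (height t) by rewrite mulr_gt0// subr_gt0.
  by rewrite /chord_width => h; lra.
have n0 : nbhs p [set x | y0 < dotp u x] := cu _ (lt_nbhsr b0).
have n1 : nbhs p [set x | dotp u x < y1] := cu _ (lt_nbhsl b1).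
have n2 : nbhs p [set x | 0 < dotp v x - dotp v (lft (dotp u x))] :=
  cl _ (lt_nbhsr b2).
have n3 : nbhs p [set x | 0 < dotp v (rgt (dotp u x)) - dotp v x] :=
  cr _ (lt_nbhsr b3).
apply: filterS (filterI (filterI n0 n1) (filterI n2 n3)).
move=> x [[/= /ltW a0 /ltW a1] [/ltW a2 /ltW a3]].
have hx : y0 <= dotp u x <= y1 by rewrite a0 a1.
rewrite /lft /rgt clamp_id// !subr_ge0 in a2 a3.
have hx' : dotp v (left (dotp u x)) <= dotp v x <= dotp v (right (dotp u x)).
  by rewrite a2 a3.
have [k k01 ->] := on_chord hx hx'.
have [Dl _ _] := leftP hx; have [Dr _ _] := rightP hx.
move: Dl Dr; set pl := left _; set pr := right _ => Dl Dr.
suff -> : pl + k *: (pr - pl) = (1 - k) *: pl + k *: pr by exact: convD.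
by apply: injective_projections => /=; rewrite /GRing.scale/=; ring.
Qed.

Let boundary_left y : y0 <= y <= y1 -> boundary D (left y).
Proof.
move=> hy; have [Dl ul hl] := leftP hy; split; first exact: subset_closure.
move=> /nbhs_enormP[e e0 he].
have : D (left y - (e / 2) *: v).
  apply: he; rewrite addrC addKr enormN enormZ v1 mulr1 ger0_norm; lra.
move=> /hl; rewrite !dotpBr !dotpZr uv vv ul mulr0 subr0 mulr1 => /(_ erefl).
by lra.
Qed.

Let boundary_right y : y0 <= y <= y1 -> boundary D (right y).
Proof.
move=> hy; have [Dl ul hl] := rightP hy; split; first exact: subset_closure.
move=> /nbhs_enormP[e e0 he].
have : D (right y + (e / 2) *: v).
  apply: he; rewrite addrC addKr enormZ v1 mulr1 ger0_norm; lra.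
move=> /hl; rewrite !dotpNl !dotpDr !dotpZr uv vv ul mulr0 addr0 mulr1 => /(_ erefl).
by lra.
Qed.

Let left0 : left y0 = P0.
Proof.
have [Dl ul _] : chord_end D u v y0 (left y0) by apply: leftP; rewrite lexx ltW.
by apply: min0 => //; rewrite ul.
Qed.

Let right0 : right y0 = P0.
Proof.
have [Dl ul _] : chord_end D u (- v) y0 (right y0) by apply: rightP; rewrite lexx ltW.
by apply: min0 => //; rewrite ul.
Qed.

Let left1 : left y1 = P1.
Proof.
have [Dl ul _] : chord_end D u v y1 (left y1) by apply: leftP; rewrite lexx ltW.
by apply: max1 => //; rewrite ul.
Qed.

Let right1 : right y1 = P1.
Proof.
have [Dl ul _] : chord_end D u (- v) y1 (right y1) by apply: rightP; rewrite lexx ltW.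
by apply: max1 => //; rewrite ul.
Qed.

Lemma chord_sweep0 s : chord_sweep (s, 0) = P0.
Proof.
rewrite chord_sweepE ?lexx ?ler01// /height mul0r addr0 left0 right0.
by rewrite subrr scaler0 addr0.
Qed.

Lemma chord_sweep1 s : chord_sweep (s, 1) = P1.
Proof.
rewrite chord_sweepE ?lexx ?ler01// /height mul1r (addrC y0) subrK left1 right1.
by rewrite subrr scaler0 addr0.
Qed.

Lemma path_length_chord (t : R) : 0 <= t <= 1 ->
  (path_length 0 1 (fun s => chord_sweep (s, t)) <= (chord_width (height t))%:E)%E.
Proof.
move=> ht; have hy := height_itv ht.
have -> : (fun s => chord_sweep (s, t)) =
    (fun s => left (height t) + s *: (chord_width (height t) *: v)).
  by apply/funext => s; rewrite chord_sweepE// chord_vector.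
apply: le_trans (path_length_segment _ _) _.
by rewrite enormZ v1 mulr1 ger0_norm// chord_width_ge0.
Qed.

Lemma chord_sweep_sensor_curve : sensor_curve D chord_sweep.
Proof.
have I01 x : unit_itv R x <-> 0 <= x <= 1 by rewrite /unit_itv /= in_itv.
have b0 : boundary D P0 by rewrite -left0; apply: boundary_left; rewrite lexx ltW.
have b1 : boundary D P1 by rewrite -left1; apply: boundary_left; rewrite lexx ltW.
split.
- exact/continuous_subspaceT/continuous_chord_sweep.
- by move=> [s t] [/= /I01 hs /I01 ht]; exact: chord_sweep_in.
- move=> t /andP[t0 t1].
  by apply: le_lt_trans (path_length_chord _) (ltry _); rewrite !ltW.
- move=> t ht s s' _ _ e.
  have ht' : 0 <= t <= 1 by case/andP: ht => a b; rewrite !ltW.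
  have := dotv_chord_sweep s ht'; rewrite e dotv_chord_sweep// => /addrI /mulIf.
  by rewrite gt_eqF ?chord_width_gt0 ?height_lt// => /(_ isT).
- by exists P0 => // s _; exact: chord_sweep0.
- by exists P1 => // s _; exact: chord_sweep1.
- move=> s t /I01 hs /I01 ht; split; last first.
    case=> [[]|[]] ->.
    + by rewrite chord_sweepE// scale0r addr0; exact/boundary_left/height_itv.
    + rewrite chord_sweepE// scale1r addrC subrK; exact/boundary_right/height_itv.
    + by rewrite chord_sweep0.
    + by rewrite chord_sweep1.
  move=> [_ nint].
  have [->|s0] := eqVneq s 0; first by left; left.
  have [->|s1] := eqVneq s 1; first by left; right.
  have [->|t0] := eqVneq t 0; first by right; left.
  have [->|t1] := eqVneq t 1; first by right; right.
  exfalso; apply: nint; apply: chord_sweep_interior.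
    by case/andP: hs => a b; rewrite !lt_neqAle a b s1 eq_sym s0.
  by case/andP: ht => a b; rewrite !lt_neqAle a b t1 eq_sym t0.
Qed.

(** The intermediate value theorem for the height of the evader minus the height of the current
    chord: the evader cannot start below the first chord nor end above the last one. *)
Lemma chord_sweep_sweep : sweep D chord_sweep.
Proof.
split; first exact: chord_sweep_sensor_curve.
move=> g cg gD.
have cphi : {within `[0, 1], continuous ((dotp u \o g) - height)}.
  apply: within_continuousB; last exact: continuous_subspaceT continuous_height.
  by apply: within_continuous_comp cg => x _; exact: continuous_dotpr.
have g0 : D (g 0) by apply: gD; rewrite /unit_itv /= in_itv/= lexx ler01.
have g1 : D (g 1) by apply: gD; rewrite /unit_itv /= in_itv/= lexx ler01.
have := y_range g0; have := y_range g1 => /andP[_ h1] /andP[h0 _].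
have e0 : height 0 = y0 by rewrite /height mul0r addr0.
have e1 : height 1 = y1 by rewrite /height mul1r addrC subrK.
have bd : Num.min (((dotp u \o g) - height) 0) (((dotp u \o g) - height) 1) <= 0 <=
   Num.max (((dotp u \o g) - height) 0) (((dotp u \o g) - height) 1).
  rewrite ge_min le_max !fctE /= e0 e1; apply/andP; split; apply/orP.
    by right; rewrite subr_le0.
  by left; rewrite subr_ge0.
have [t tI ht] := IVT ler01 cphi bd.
have It : unit_itv R t by [].
have t01 : 0 <= t <= 1 by move: It; rewrite /unit_itv /= in_itv.
have ug : dotp u (g t) = height t by apply/subr0_eq.
have Dg := gD _ It.
have [s s01 hs] := on_chord (y_range Dg) (chord_le Dg).
exists t => //; exists s; first by rewrite /unit_itv /= in_itv.
by rewrite chord_sweepE// -ug -hs.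
Qed.

Lemma chord_sweep_length (B : \bar R) :
  (forall p m, 0 <= m -> D p -> D (p + m *: v) -> (m%:E <= B)%E) ->
  (sensor_length chord_sweep <= B)%E.
Proof.
move=> hB; apply: ge_ereal_sup => _ [t ht <-].
have {}ht : 0 <= t <= 1 by move: ht; rewrite /unit_itv /= in_itv.
apply: le_trans (path_length_chord ht) _.
have hy := height_itv ht.
have [Dl _ _] := leftP hy; have [Dr _ _] := rightP hy.
apply: (hB (left (height t))) => //; first exact: chord_width_ge0.
by rewrite -chord_vector// addrC subrK.
Qed.

End ChordSweep.

(** * Tilting a direction *)

Section FlatSlopes.
Context {R : realType} (T : Type) (D : set T).

Definition maximizer (h : T -> R) (p : T) := D p /\ forall x, D x -> h x <= h p.

(** For linear coordinates [h] and [g] on a convex set, these slopes correspond to supporting lines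
    that meet the set in a nondegenerate segment. *)
Definition flat_slopes (h g : T -> R) : set R := [set k | exists p q,
  [/\ maximizer (fun x => h x + k * g x) p,
      maximizer (fun x => h x + k * g x) q & g p < g q]].

(* The intervals ]g p, g q[ attached to different slopes are disjoint, so each
   of them can be labelled by a rational of its own. *)
Lemma countable_flat_slopes (h g : T -> R) : countable (flat_slopes h g).
Proof.
have hr k : exists a : rat, flat_slopes h g k -> exists p q,
    [/\ maximizer (fun x => h x + k * g x) p,
        maximizer (fun x => h x + k * g x) q & g p < ratr a < g q].
  have [[p [q [mp mq pq]]]|nk] := pselect (flat_slopes h g k); last by exists 0.
  have [a ha] := rat_in_itvoo pq; exists a => _.
  by exists p, q; split => //; move: ha; rewrite in_itv.
have [rho rhoP] := choice hr.
(* Testing the maximality of [q] for [k] against [p'], and that of [p'] for [k'] against [q], gives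
   [g q <= g p']: the intervals come in the order of the slopes. *)
have mono k k' : flat_slopes h g k -> flat_slopes h g k' -> k < k' ->
    (ratr (rho k) : R) < ratr (rho k').
  move=> /rhoP[p [q [_ [Dq mq] /andP[_ h1]]]] /rhoP[p' [q' [[Dp' mp'] _ /andP[h2 _]]]] kk.
  have e1 := mq _ Dp'; have e2 := mp' _ Dq.
  apply: lt_trans h1 (le_lt_trans _ h2).
  have : 0 <= (k' - k) * (g p' - g q) by lra.
  by rewrite pmulr_rge0 ?subr_gt0// subr_ge0.
apply/countable_injP; exists (fun k => choice.pickle (rho k)).
move=> k k' /set_mem Bk /set_mem Bk' /(pcan_inj choice.pickleK) e.
case: (ltgtP k k') => // kk.
  by have := mono _ _ Bk Bk' kk; rewrite e ltxx.
by have := mono _ _ Bk' Bk kk; rewrite e ltxx.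
Qed.

(** The negated functions account for minima as well as maxima. The excluded slopes are countable,
    hence of measure zero, while the interval from 0 to [e] has positive measure. *)
Lemma non_flat_slope (h g : T -> R) (e : R) : 0 < e ->
  exists2 k : R, 0 < k < e &
    ~ flat_slopes h g k /\ ~ flat_slopes (fun x => - h x) (fun x => - g x) k.
Proof.
move=> e0; apply: contrapT => nk.
pose F (b : bool) := if b then flat_slopes h g
  else flat_slopes (fun x => - h x) (fun x => - g x).
have cF : countable (\bigcup_(b in [set: bool]) F b).
  apply: bigcup_countable => // b _.
  by case: b; exact: countable_flat_slopes.
have sub : `]0, e[%classic `<=` \bigcup_(b in [set: bool]) F b.
  move=> k /=; rewrite in_itv/= => hk; apply: contrapT => nF.
  by apply: nk; exists k => //; split => fk; apply: nF; [exists true | exists false].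
have := countable_lebesgue_measure0 (sub_countable (subset_card_le sub) cF).
rewrite lebesgue_measure_itv/= lte_fin e0 oppr0 adde0 => /eqP.
by rewrite eqe gt_eqF.
Qed.

End FlatSlopes.

(** * The width is an upper bound for the sweeping cost *)

Section UpperBound.
Context {R : realType} (D : set (R * R)).
Hypotheses (cD : compact D) (convD : convex_comb_closed D).

Let closedD : closed D.
Proof. by apply: compact_closed cD; exact: norm_hausdorff. Qed.

Lemma le_chord_length (p v : R * R) (m : R) : 0 <= m -> D p -> D (p + m *: v) ->
  (m%:E <= chord_length D p v)%E.
Proof.
move=> m0 Dp Dq.
rewrite -[X in X%:E]subr0 -(lebesgue_measure_segment m0); apply: le_measure.
- by apply/mem_set; exact: measurable_itv.
- by apply/mem_set; exact: chord_measurable.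
- move=> k /=; rewrite in_itv/= => /andP[k0 km].
  have [mz|mn] := eqVneq m 0.
    have -> : k = 0 by apply: le_anti; rewrite k0 -mz km.
    by rewrite scale0r addr0.
  have mp : 0 < m by rewrite lt_neqAle eq_sym mn.
  have -> : p + k *: v = (1 - k / m) *: p + (k / m) *: (p + m *: v).
    by apply: injective_projections; rewrite /= /GRing.scale/=; field.
  by apply: convD => //; rewrite divr_ge0//= ler_pdivrMr// mul1r.
Qed.

(** Two maximizers agree in [g] because the slope is not flat, hence also in [h]. *)
Lemma unique_maximizer (h g : R * R -> R) (k : R) : continuous h -> continuous g ->
  D !=set0 -> (forall x y, h x = h y -> g x = g y -> x = y) ->
  ~ flat_slopes D h g k -> exists2 P, D P &
    forall x, D x -> h P + k * g P <= h x + k * g x -> x = P.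
Proof.
move=> ch cg Dne inj nk.
have c : continuous (fun x => h x + k * g x).
  by move=> x; apply: (cvgD (ch x) (cvgM (cvg_cst k) (cg x))).
have [P /set_mem DP maxP] := compact_EVT_max Dne cD (continuous_subspaceT c).
have mP : maximizer D (fun x => h x + k * g x) P.
  by split => // x Dx; exact/maxP/mem_set.
exists P => // x Dx hx.
have mx : maximizer D (fun x => h x + k * g x) x.
  by split => // y Dy; apply: le_trans hx; exact: mP.2.
have e : h x + k * g x = h P + k * g P by apply: le_anti; rewrite hx mP.2.
case: (ltgtP (g x) (g P)) => [lt|lt|eg].
- by exfalso; apply: nk; exists x, P.
- by exfalso; apply: nk; exists P, x.
- by apply: inj => //; move: e; rewrite eg => /addIr.
Qed.

Lemma sweep_of_direction (v P0 P1 c : R * R) (r : R) (B : \bar R) :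
  enorm v = 1 -> D P0 -> D P1 -> 0 < r ->
  (forall x, enorm (x - c) <= r -> D x) ->
  (forall x, D x -> dotp (perp v) x <= dotp (perp v) P0 -> x = P0) ->
  (forall x, D x -> dotp (perp v) P1 <= dotp (perp v) x -> x = P1) ->
  (forall p m, 0 <= m -> D p -> D (p + m *: v) -> (m%:E <= B)%E) ->
  (sweeping_cost D <= B)%E.
Proof.
move=> v1 D0 D1 r0 ballD min0 max1 hB.
have ex w : exists L : R -> R * R, forall y, dotp (perp v) P0 <= y <= dotp (perp v) P1 ->
    chord_end D (perp v) w y (L y).
  have h y : exists p, dotp (perp v) P0 <= y <= dotp (perp v) P1 ->
      chord_end D (perp v) w y p.
    have [hy|nhy] := pselect (dotp (perp v) P0 <= y <= dotp (perp v) P1);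
      last by exists 0.
    have [p hp] := chord_end_exists w cD convD D0 D1 hy.
    by exists p.
  by have [L LP] := choice h; exists L.
have [left leftP] := ex v; have [right rightP] := ex (- v).
apply: ge_ereal_inf; exists (sensor_length (chord_sweep v P0 P1 left right)).
  exists (chord_sweep v P0 P1 left right) => //.
  exact: (chord_sweep_sweep cD convD v1 D0 D1 r0 ballD min0 max1 leftP rightP).
exact: (chord_sweep_length v1 r0 ballD min0 max1 leftP rightP hB).
Qed.

(* A slightly tilted direction admits chords hardly longer than those in
   direction v: contracting D towards c leaves room to straighten them. *)
Lemma sweeping_cost_le_chord (v : R * R) : (exists c, interior D c) -> enorm v = 1 ->
  (sweeping_cost D <= ereal_sup [set chord_length D x v | x in [set: R * R]])%E.
Proof.
move=> /interior_ball[c [r r0 ballD]] v1.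
set B := ereal_sup _.
have [K K0 diamD] := compact_enorm_bounded cD.
have Dne : D !=set0 by exists c; apply: ballD; rewrite subrr enorm0 ltW.
have vv := enorm_unit v1.
pose u := perp v.
have un : enorm u = 1 by rewrite enorm_perp.
have uu := enorm_unit un.
have uv : dotp u v = 0 := perp_orth v.
have vu : dotp v u = 0 by rewrite dotpC.
apply/lee_addgt0Pr => e e0.
(* The contraction ratio towards [c] is [1 - l]; this [l] is at most 1 and costs at most [e / 2] in
   length. *)
pose l := e / (2 * K + 2 * e).
have den0 : 0 < 2 * K + 2 * e by rewrite addr_gt0// mulr_gt0.
have l0 : 0 < l by rewrite divr_gt0.
have l1 : l <= 1 by rewrite ler_pdivrMr// mul1r; lra.
have lK : l * K <= e / 2.
  rewrite /l mulrAC ler_pdivrMr//.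
  have : 0 <= e * e by rewrite mulr_ge0 ?ltW.
  by lra.
(* The first bound on the tilt keeps the straightened chord within the room left by the ball, the
   second limits the lengthening to [e / 2]. *)
pose kap := Num.min (l * r / K) (e / (2 * K)).
have kap0 : 0 < kap.
  by rewrite lt_min; apply/andP; split; apply: divr_gt0 => //; exact: mulr_gt0.
have [k /andP[k0]] := non_flat_slope D (dotp u) (dotp v) kap0.
rewrite lt_min => /andP[ka kb] [nf1 nf0].
have kr : k * K <= l * r by rewrite -ler_pdivlMr// ltW.
have kK : k * K <= e / 2.
  rewrite -ler_pdivlMr//; apply: ltW; suff -> : e / 2 / K = e / (2 * K) by [].
  by field; rewrite gt_eqF.
have inj x y : dotp u x = dotp u y -> dotp v x = dotp v y -> x = y.
  by move=> h1 h2; rewrite (orth_decomp x v1) (orth_decomp y v1) h1 h2.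
have [P1 D1 max1] := unique_maximizer (@continuous_dotpr R u) (@continuous_dotpr R v)
  Dne inj nf1.
have cN w : continuous (fun x => - dotp w x : R).
  by move=> x; apply: cvgN; exact: continuous_dotpr.
have [P0 D0 min0] : exists2 P, D P & forall x, D x ->
    - dotp u P + k * - dotp v P <= - dotp u x + k * - dotp v x -> x = P.
  apply: unique_maximizer Dne _ nf0; [exact: cN | exact: cN |].
  by move=> x y /oppr_inj h1 /oppr_inj; exact: inj.
(* Here [perp w = u + k *: v], so the height for direction [w] is, up to a positive factor, the
   functional with unique extremal points. *)
pose w := v - k *: u.
have ww : dotp w w = 1 + k ^+ 2.
  by rewrite /w !(dotpBr, dotpBl, dotpZl, dotpZr) uv vu uu vv; ring.
have w1 : 1 <= enorm w.
  rewrite leNgt; apply/negP => h; have : enorm w ^+ 2 < 1.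
    by rewrite expr_lt1// enorm_ge0.
  by rewrite enorm_sqr ww gtrDl ltNge sqr_ge0.
have wk : enorm w <= 1 + k.
  by rewrite enorm_le ?ww ?addr_ge0 ?(ltW k0)//; move: (k0) => kk; nra.
have w0 : w != 0 by apply/eqP => h; move: w1; rewrite h enorm0; lra.
have wg := enorm_gt0 w0.
have perpw x : dotp (perp (normalize w)) x = (enorm w)^-1 * (dotp u x + k * dotp v x).
  by rewrite /normalize /w /u /dotp /perp /= /GRing.scale/=; ring.
apply: (@sweep_of_direction (normalize w) P0 P1 c r) => //.
- exact: enorm_normalize.
- move=> x Dx; rewrite !perpw ler_pM2l ?invr_gt0// => h; apply: min0 => //.
  by lra.
- by move=> x Dx; rewrite !perpw ler_pM2l ?invr_gt0//; exact: max1.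
move=> p m m0 Dp Dq.
pose m' := m / enorm w.
have m'0 : 0 <= m' by rewrite divr_ge0// ltW.
have qE : p + m *: normalize w = p + m' *: w by rewrite /normalize scalerA.
have mm' : m = m' * enorm w by rewrite divfK// gt_eqF.
have m'm : m' <= m by rewrite mm' ler_peMr.
have mK : m <= K.
  have := diamD _ _ Dq Dp; rewrite addrC addKr enormZ enorm_normalize//.
  by rewrite mulr1 ger0_norm.
have hE : 0 <= (1 - l) * m' by rewrite mulr_ge0// subr_ge0.
pose P := (1 - l) *: p + l *: c.
have DP : D P.
  by apply: convD; rewrite ?(ltW l0)//; apply: ballD; rewrite subrr enorm0 ltW.
have DQ : D (P + ((1 - l) * m') *: v).
  (* The shift of the ball point along [u] cancels the component [- k *: u] of the tilted chord. *)
  have -> : P + ((1 - l) * m') *: v = (1 - l) *: (p + m' *: w) +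
      l *: (c + ((1 - l) * k * m' / l) *: u).
    by apply: injective_projections; rewrite /P /w /= /GRing.scale/=; field;
      rewrite gt_eqF.
  apply: convD; rewrite ?(ltW l0)//; first by rewrite -qE.
  apply: ballD; rewrite addrC addKr enormZ un mulr1.
  have km0 : 0 <= k * m' by rewrite mulr_ge0// ltW.
  rewrite ger0_norm; last by rewrite divr_ge0 ?(ltW l0)// -mulrA mulr_ge0// subr_ge0.
  rewrite ler_pdivrMr// (mulrC r); apply: le_trans kr; rewrite -mulrA.
  have : k * m' <= k * K by rewrite ler_pM2l//; exact: le_trans mK.
  by apply: le_trans; rewrite ler_piMl//; lra.
have : (((1 - l) * m')%:E <= B)%E.
  apply: le_trans (le_chord_length hE DP DQ) _.
  by apply: ereal_sup_ubound; exists P.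
(* [m] exceeds [(1 - l) * m'] by at most [l * m' + k * m'], and each of these terms is at most
   [e / 2]. *)
move=> hB; apply: le_trans (leeD hB (lexx e%:E)); rewrite -EFinD lee_fin.
have h1 : l * m' <= l * K by rewrite ler_pM2l//; exact: le_trans mK.
have h2 : k * m' <= k * K by rewrite ler_pM2l//; exact: le_trans mK.
have h3 : m <= m' * (1 + k) by rewrite {1}mm' ler_wpM2l.
by lra.
Qed.

End UpperBound.

Theorem theorem8p1 (R : realType) (D : set (R * R))
    (D_jordan : jordan_domain D) (D_convex : convex_set D) :
  sweeping_cost D = width D.
Proof.
have convD := convex_setP D_convex.
have cD := jordan_domain_compact D_jordan.
have iD := jordan_domain_interior D_jordan convD.
apply: le_anti; apply/andP; split.
  by apply: le_ereal_inf_tmp => _ [v v1 <-]; exact: sweeping_cost_le_chord.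
by apply: le_ereal_inf_tmp => _ [f sf <-]; exact: width_le_sensor_length.
Qed.
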